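(* Let $\{a_n\}_{n\in\mathbb{Z}}$ and $\{b_n\}_{n\in\mathbb{Z}}$ be symmetric, primitive random walks on $\mathbb{Z}$ such that for every positive integer $k$ the $k$-th return probability of $\{a_n\}$ equals the $k$-th return probability of $\{b_n\}$. Then $a_n=b_n$ for all $n\in\mathbb{Z}$.
   Context: A random walk on $\mathbb{Z}$ is a family $\{a_n\}_{n\in\mathbb{Z}}$ of nonnegative real numbers with $\sum_{n\in\mathbb{Z}}a_n=1$, where $a_n$ is the probability of moving $n$ steps in one unit of time. Standing assumption on every random walk considered: $\limsup_{n\to\infty} a_n^{1/n}<1$. The random walk is symmetric if $a_n=a_{-n}$ for all $n$. Its set of step sizes is $\{|n| : a_n\neq 0\}$; it is primitive if the set of step sizes generates $\mathbb{Z}$ as a group. The $k$-th return probability is $\Pr[x_1+\cdots+x_k=0]$, where $x_1,\dots,x_k$ are i.i.d. integer-valued random variables with $\Pr[x_i=n]=a_n$. *)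

(* Defs.v *)
From HB Require Import structures.
From mathcomp Require Import all_boot all_order all_algebra.
From mathcomp Require Import all_classical all_reals all_analysis.

Set Implicit Arguments.
Unset Strict Implicit.
Unset Printing Implicit Defensive.

Import Order.TTheory GRing.Theory Num.Theory.
Import numFieldNormedType.Exports.

Local Open Scope classical_set_scope.
Local Open Scope ring_scope.

HB.instance Definition _ := isPointed.Build int 0.
HB.instance Definition _ := @isMeasurable.Build default_measure_display
  int discrete_measurable discrete_measurable0
  discrete_measurableC discrete_measurableU.

Record random_walk (R : realType) (a : int -> R) : Prop := RandomWalk {
  walk_ge0 : forall n, 0 <= a n;
  walk_sum1 : (\esum_(n in [set: int]) (a n)%:E = 1)%E;
  (* `^ is the real power, with 0 `^ r = 0 for r != 0; the term n = 0 plays no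
     role in the limit superior. *)
  walk_limsup : (limn_esup (fun n : nat => (a n%:Z `^ n%:R^-1)%:E) < 1)%E }.

Definition symmetric_walk (R : realType) (a : int -> R) : Prop :=
  forall n, a n = a (- n).

Definition step_sizes (R : realType) (a : int -> R) : set int :=
  [set m | exists2 n : int, a n != 0 & m = `|n|].

Definition int_subgroup (H : set int) : Prop :=
  H 0 /\ forall m n, H m -> H n -> H (m - n).

Definition generated_subgroup (S : set int) : set int :=
  smallest int_subgroup S.

Definition primitive_walk (R : realType) (a : int -> R) : Prop :=
  generated_subgroup (step_sizes a) = [set: int].

Record iid_steps (R : realType) (a : int -> R) (d : measure_display)
    (T : measurableType d) (P : probability T R) (k : nat)
    (X : 'I_k -> {RV P >-> int}) : Prop := IidSteps {
  iid_law : forall i n, P (X i @^-1` [set n]) = (a n)%:E;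
  iid_indep : forall B : 'I_k -> set int,
    P [set t | forall i, B i (X i t)] = (\prod_(i < k) P (X i @^-1` B i))%E }.

Arguments iid_steps {R} a {d T} P {k} X.

Definition is_return_probability (R : realType) (a : int -> R) (k : nat)
    (p : \bar R) : Prop :=
  exists (d : measure_display) (T : measurableType d) (P : probability T R)
    (X : 'I_k -> {RV P >-> int}),
    iid_steps a P X /\ P [set t | \sum_(i < k) X i t = 0] = p.

Lemma is_return_probability_unique (R : realType) (a : int -> R) (k : nat)
    (p q : \bar R) :
  is_return_probability a k p -> is_return_probability a k q -> p = q.
Proof.
suff main d (T : measurableType d) (P : probability T R)
    (X : 'I_k -> {RV P >-> int}) : iid_steps a P X ->
    P [set t | \sum_(i < k) X i t = 0] =
    (\sum_(0 <= n <oo) if pickle_inv n is Some x then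
       if (\sum_(i < k) (x : {ffun 'I_k -> int}) i == 0)%R
       then \prod_(i < k) (a (x i))%:E else 0 else 0)%E.
  by move=> [d [T [P [X [aX <-]]]]] [d' [T' [P' [X' [aX' <-]]]]]; rewrite !main.
move=> aX.
pose B (x : {ffun 'I_k -> int}) := [set t | forall i, X i t = x i].
have PB x : P (B x) = (\prod_(i < k) (a (x i))%:E)%E.
  have := iid_indep aX (fun i => [set x i]); rewrite -/(B x) => ->.
  by apply: eq_bigr => i _; exact: iid_law aX _ _.
pose F (n : nat) : set T := if pickle_inv n is Some x then
  if \sum_(i < k) (x : {ffun 'I_k -> int}) i == 0 then B x else set0 else set0.
have mB x : measurable (B x).
  have -> : B x = \bigcap_(i in [set: 'I_k]) (X i @^-1` [set x i]).
    by apply/seteqP; split=> t /= h i => [_|]; exact: h.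
  apply: fin_bigcap_measurable => [|i _]; first exact: finite_finset.
  by rewrite -[_ @^-1` _]setTI; exact: measurable_funP.
have -> : [set t | \sum_(i < k) X i t = 0] = \bigcup_n F n.
  apply/seteqP; split=> t /=.
    move=> Xt0; pose x := [ffun i => X i t].
    exists (pickle x) => //; rewrite /F pickleK_inv.
    have -> : \sum_(i < k) x i = 0.
      by rewrite -[RHS]Xt0; apply: eq_bigr => i _; rewrite ffunE.
    by rewrite eqxx /B /= => i; rewrite ffunE.
  move=> [n _]; rewrite /F; case: pickle_inv => [x|//].
  case: eqP => // x0 /= Xtx; rewrite -[RHS]x0.
  by under eq_bigr do rewrite Xtx.
rewrite measure_bigcup; first last.
- apply/trivIsetP => i j _ _ ij; apply/seteqP; split=> // t [] /=.
  have := @pickle_invK {ffun 'I_k -> int} i.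
  have := @pickle_invK {ffun 'I_k -> int} j.
  rewrite /F; case: (pickle_inv j) => [y|] // /= yj.
  case: (pickle_inv i) => [x|] // /= xi.
  case: eqP => // _; case: eqP => // _ Xx Xy; move/eqP: ij; apply.
  by rewrite -xi -yj; congr pickle; apply/ffunP => l; rewrite -Xx -Xy.
- move=> n _; rewrite /F; case: pickle_inv => [x|//]; first by case: ifP.
rewrite (eq_eseriesl (Q := xpredT)) => [|n]; last by rewrite in_setT.
apply: eq_eseriesr => n _.
rewrite /F; case: pickle_inv => [x|]; last exact: measure0.
by case: ifP => _; [exact: PB|exact: measure0].
Qed.

Definition step_measure (R : realType) (a : int -> R) (A : set int) : \bar R :=
  (\esum_(n in A) (a n)%:E)%E.

Lemma is_return_probability_ex (R : realType) (a : int -> R) (k : nat) :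
  random_walk a -> exists p, is_return_probability a k p.
Proof.
move=> [a_ge0 a_sum1 _].
have a0 n : (0 <= (a n)%:E)%E by rewrite lee_fin.
have mu0 : step_measure a set0 = 0%E by exact: esum_set0.
have mu_ge0 A : (0 <= step_measure a A)%E by exact: esum_ge0.
have mu_sigma : semi_sigma_additive (step_measure a).
  move=> F mF tF mUF; rewrite /step_measure esum_bigcupT //.
  rewrite -nneseries_esumT => [|n]; last exact: esum_ge0.
  by apply: is_cvg_nneseries => n _ _; exact: esum_ge0.
pose mu_measure := isMeasure.Build _ _ _ (step_measure a) mu0 mu_ge0 mu_sigma.
pose mu0' : measure int R := HB.pack (step_measure a) mu_measure.
pose mu_prob := Measure_isProbability.Build _ _ _ mu0' a_sum1.
pose mu : probability int R := HB.pack (step_measure a) mu_measure mu_prob.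
suff [d [T [P [X aX]]]] : exists (d : measure_display) (T : measurableType d)
    (P : probability T R) (X : 'I_k -> {RV P >-> int}), iid_steps a P X.
  by exists (P [set t | \sum_(i < k) X i t = 0]), d, T, P, X.
elim: k => [|k [d [T [P [X aX]]]]].
  exists default_measure_display, unit, (\d_tt : probability unit R).
  exists (fun=> cst 0 : {mfun unit >-> int}); split=> [[]//|B].
  rewrite big_ord0 (_ : [set t | _] = setT) ?probability_setT//.
  by apply/seteqP; split=> // t _ [].
pose Q : probability (int * T)%type R := (mu \x P)%E.
have QE A B : measurable B -> Q (A `*` B) = (mu A * P B)%E.
  by move=> mB; exact: (@product_measure1E _ _ _ _ _ mu P A B).
pose Y (i : 'I_k.+1) (z : int * T) : int :=
  if unlift ord0 i is Some j then X j z.2 else z.1.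
have mY i : measurable_fun setT (Y i).
  rewrite /Y; case: unliftP => [j _|_]; last exact: measurable_fst.
  by apply: measurableT_comp => //; exact: measurable_funP.
pose Z i : {mfun (int * T)%type >-> int} :=
  HB.pack (Y i) (isMeasurableFun.Build _ _ _ _ _ (mY i)).
have Z0 B : Z ord0 @^-1` B = B `*` setT.
  by apply/seteqP; split=> -[n t]; rewrite /= /Y unlift_none //; case.
have ZS j B : Z (lift ord0 j) @^-1` B = setT `*` (X j @^-1` B).
  by apply/seteqP; split=> -[n t]; rewrite /= /Y liftK //; case.
have mX j B : measurable (X j @^-1` B).
  by rewrite -[_ @^-1` _]setTI; exact: measurable_funP.
have muT : mu setT = 1%E by exact: probability_setT.
have QZ0 B : Q (Z ord0 @^-1` B) = mu B.
  by rewrite Z0 QE// probability_setT mule1.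
have QZS j B : Q (Z (lift ord0 j) @^-1` B) = P (X j @^-1` B).
  by rewrite ZS QE// muT mul1e.
exists _, (int * T)%type, Q, Z; split=> [i n|B].
  case: (unliftP ord0 i) => [j|] ->; first by rewrite QZS (iid_law aX).
  by rewrite QZ0 /mu /= /step_measure esum_set1.
rewrite big_ord_recl QZ0; under eq_bigr do rewrite QZS.
rewrite -(iid_indep aX (fun j => B (lift ord0 j))) -QE; last first.
  rewrite (_ : [set t | _] =
      \bigcap_(j in [set: 'I_k]) (X j @^-1` B (lift ord0 j))).
    apply: fin_bigcap_measurable => [|j _]; first exact: finite_finset.
    exact: mX.
  by apply/seteqP; split=> t /= h j => [_|]; exact: h.
congr (Q _); apply/seteqP; split=> -[n t] /=.
  move=> h; split; first by have := h ord0; rewrite /Y unlift_none.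
  by move=> j; have := h (lift ord0 j); rewrite /Y liftK.
move=> [h0 h] i; rewrite /Y.
by case: (unliftP ord0 i) => [j|] -> //; exact: h.
Qed.

(* For a random walk, xget never returns its default 0: by
   is_return_probability_ex and is_return_probability_unique there is exactly
   one p with is_return_probability a k p. *)
Definition return_probability (R : realType) (a : int -> R) (k : nat) :
    \bar R :=
  xget 0%E [set p | is_return_probability a k p].

Lemma return_probabilityE (R : realType) (a : int -> R) (d : measure_display)
    (T : measurableType d) (P : probability T R) (k : nat)
    (X : 'I_k -> {RV P >-> int}) :
  iid_steps a P X ->
  return_probability a k = P [set t | \sum_(i < k) X i t = 0].
Proof.
move=> aX; set p := P _.
have ap : is_return_probability a k p by exists d, T, P, X.
by apply: (is_return_probability_unique _ ap); apply: xgetPex; exists p.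
Qed.

(* Main.v *)
(* Write phi_a(t) = sum_n a_n cos(n t). The k-th return probability of a is the
   average of phi_a^k over the circle, so the averages of p(phi_a) and p(phi_b)
   agree for every polynomial p. If phi_a and phi_b differ, their Taylor
   expansions at 0 differ, because the exponential decay of the coefficients
   makes them analytic; say phi_a - phi_b >= mu t^(2j) with mu > 0 near 0. Take
   p(x) = ((1 + x)/2)^k. By primitivity (1 + phi_b)/2 is bounded by some r < 1
   away from 0, while on a small interval close to 0 it exceeds some q > r, so
   for large k the gap between the two averages produced by that interval, of
   order q^k, cannot be compensated by the rest of the circle, of order r^k.

   Averages over the circle are replaced by averages over the N-th roots of
   unity with N -> oo: on trigonometric polynomials of degree < N the two agree,
   and only finite sums have to be interchanged. *)

Require Import Defs.
From mathcomp Require Import all_boot all_order all_algebra.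
From mathcomp Require Import all_classical all_reals all_analysis.
From mathcomp Require Import complex ring lra zify.

Set Implicit Arguments.
Unset Strict Implicit.
Unset Printing Implicit Defensive.

Import Order.TTheory GRing.Theory Num.Theory.
Import numFieldNormedType.Exports.

Local Open Scope classical_set_scope.
Local Open Scope ring_scope.

(** * Averages over roots of unity *)

Section TrigMeans.
Variable R : realType.
Implicit Types (t s : R) (N n : nat).

Definition mean N (f : R -> R) : R :=
  (\sum_(j < N) f (j%:R * (pi *+ 2 / N%:R))) / N%:R.

Lemma eq_mean N (f g : R -> R) : f =1 g -> mean N f = mean N g.
Proof. by move=> fg; congr (_ / _); apply: eq_bigr => j _; rewrite fg. Qed.

Lemma meanZ N c (f : R -> R) : mean N (fun t => c * f t) = c * mean N f.
Proof. by rewrite /mean -mulr_sumr mulrA. Qed.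

Lemma mean_sum (I : finType) (P : pred I) N (F : I -> R -> R) :
  mean N (fun t => \sum_(i | P i) F i t) = \sum_(i | P i) mean N (F i).
Proof. by rewrite /mean exchange_big /= mulr_suml. Qed.

Lemma meanB N (f g : R -> R) :
  mean N (fun t => f t - g t) = mean N f - mean N g.
Proof. by rewrite /mean sumrB mulrBl. Qed.

Lemma ler_mean N (f g : R -> R) :
  (forall t, f t <= g t) -> mean N f <= mean N g.
Proof.
by move=> fg; rewrite ler_wpM2r ?invr_ge0 ?ler0n//; apply: ler_sum => j _.
Qed.

Lemma mean_cst N c : (0 < N)%N -> mean N (fun=> c) = c.
Proof.
move=> N0; rewrite /mean sumr_const card_ord -[c *+ N]mulr_natr mulfK //.
by rewrite pnatr_eq0 -lt0n.
Qed.

Lemma mean_dist N (f g : R -> R) e : (0 < N)%N ->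
  (forall t, `|f t - g t| <= e) -> `|mean N f - mean N g| <= e.
Proof.
move=> N0 fg; rewrite -meanB ler_norml; apply/andP; split.
  rewrite -[X in X <= _](mean_cst _ N0); apply: ler_mean => t.
  by have := fg t; rewrite ler_norml => /andP[].
rewrite -[X in _ <= X](mean_cst _ N0); apply: ler_mean => t.
by have := fg t; rewrite ler_norml => /andP[].
Qed.

(** Dirichlet kernel in product form, free of any division by [sin (t / 2)]: each
    [2 * sin (t / 2) * cos (j%:R * t)] is a difference of two sines, and the sum telescopes. *)
Lemma sin_halfM_sum_cos N t :
  2 * sin (t / 2) * (\sum_(j < N) cos (j%:R * t)) =
  sin (N%:R * t - t / 2) + sin (t / 2).
Proof.
elim: N => [|N IH]; first by rewrite big_ord0 mulr0 mul0r add0r sinN addNr.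
rewrite big_ord_recr /= mulrDr IH.
have -> : N.+1%:R * t - t / 2 = N%:R * t + t / 2 by rewrite -natr1; field.
rewrite sinB sinD; ring.
Qed.

Lemma cosD2pi_nat t n : cos (t + n%:R * (pi *+ 2)) = cos t.
Proof. by rewrite mulr_natl; apply: (periodicn (@cosD2pi R)). Qed.

Lemma sinD2pi_nat t n : sin (t + n%:R * (pi *+ 2)) = sin t.
Proof. by rewrite mulr_natl; apply: (periodicn (@sinD2pi R)). Qed.

(** For [0 < n < N] the right side of the Dirichlet identity vanishes at the angle 2 pi n / N, while
    the factor sin (pi n / N) on its left side is positive. *)
Lemma mean_cos_nat N n : (n < N)%N ->
  mean N (fun t => cos (n%:R * t)) = (n == 0%N)%:R.
Proof.
move=> nN; have N0 : (0 < N)%N by apply: leq_ltn_trans nN.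
have NR0 : N%:R != 0 :> R by rewrite pnatr_eq0 -lt0n.
case: (posnP n) => [->|n0].
  under eq_mean do rewrite mul0r cos0.
  by rewrite mean_cst.
rewrite /mean; set S := \sum_(j < N) _.
suff -> : S = 0 by rewrite mul0r.
have := sin_halfM_sum_cos N (n%:R * (pi *+ 2 / N%:R)).
have -> : \sum_(j < N) cos (j%:R * (n%:R * (pi *+ 2 / N%:R))) = S.
  by apply: eq_bigr => j _; congr cos; ring.
have -> : N%:R * (n%:R * (pi *+ 2 / N%:R)) - n%:R * (pi *+ 2 / N%:R) / 2 =
    - (n%:R * (pi *+ 2 / N%:R) / 2) + n%:R * (pi *+ 2) :> R by field.
rewrite sinD2pi_nat sinN addNr => /eqP.
have : 0 < sin (n%:R * (pi *+ 2 / N%:R) / 2) :> R.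
  apply: sin_gt0_pi.
  have -> : n%:R * (pi *+ 2 / N%:R) / 2 = n%:R / N%:R * pi :> R by field.
  rewrite !mulr_gt0 ?invr_gt0 ?ltr0n ?pi_gt0 //=.
  by rewrite gtr_pMl ?pi_gt0// ltr_pdivrMr ?ltr0n// mul1r ltr_nat.
by move=> /lt0r_neq0 s0; rewrite !mulf_eq0 pnatr_eq0 (negbTE s0) => /eqP.
Qed.

Lemma mean_cos N (z : int) : (`|z| < N)%N ->
  mean N (fun t => cos (z%:~R * t)) = (z == 0)%:R.
Proof.
move=> zN; rewrite -absz_eq0 -(mean_cos_nat zN).
apply: eq_mean => t; case: z {zN} => n //=.
by rewrite NegzE mulrNz mulNr cosN.
Qed.

(** Product-to-sum leaves the frequencies n - m and n + m, both below [N] in absolute value, so the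
    grid average does not alias. This extracts Fourier coefficients from grid values. *)
Lemma mean_cosMcos N n m : (n + m < N)%N ->
  mean N (fun t => cos (n%:R * t) * cos (m%:R * t)) =
  ((n == m)%:R + ((n + m)%N == 0%N)%:R) / 2.
Proof.
move=> nmN.
have -> : ((n + m)%N == 0%N)%:R = mean N (fun t => cos ((n + m)%:R * t)).
  by rewrite mean_cos_nat.
have -> : (n == m)%:R = mean N (fun t => cos ((n%:Z - m%:Z)%:~R * t)).
  rewrite mean_cos ?subr_eq0 //.
  by apply: leq_ltn_trans nmN; lia.
rewrite /mean -mulrDl -big_split /= mulrAC; congr (_ / _).
rewrite mulr_suml; apply: eq_bigr => j _.
rewrite rmorphB /= natrD; move: (_ * (_ / _)) => t.
by rewrite (mulrDl n%:R m%:R) (mulrBl _ n%:R m%:R) cosB cosD; field.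
Qed.

(** * Powers of cosine sums through the complex exponential *)

Definition expi t : R[i] := Complex (cos t) (sin t).

Lemma expiD s t : expi (s + t) = expi s * expi t.
Proof.
apply/eqP; rewrite eq_complex /= cosD sinD eqxx /=; apply/eqP; ring.
Qed.

Lemma expi_sum (I : finType) (F : I -> R) :
  expi (\sum_i F i) = \prod_i expi (F i).
Proof.
apply: (big_morph expi expiD).
by rewrite /expi cos0 sin0.
Qed.

(** The hypothesis makes the sum of [a i * expi (v i * t)] real, so its power can be expanded by
    distributivity in the complex numbers and read off from real parts. *)
Lemma sum_cosX (I : finType) (a v : I -> R) k t :
  \sum_i a i * sin (v i * t) = 0 ->
  (\sum_i a i * cos (v i * t)) ^+ k =
  \sum_(x : {ffun 'I_k -> I})
    (\prod_i a (x i)) * cos ((\sum_i v (x i)) * t).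
Proof.
move=> sin0.
pose F i : R[i] := (a i)%:C%C * expi (v i * t).
have FE : \sum_i F i = (\sum_i a i * cos (v i * t))%:C%C.
  apply/eqP; rewrite eq_complex /= !raddf_sum /=; apply/andP; split; apply/eqP.
    by apply: eq_bigr => i _; rewrite /= mul0r subr0.
  by rewrite -[RHS]sin0; apply: eq_bigr => i _; rewrite /= mul0r addr0.
have /(congr1 (@complex.Re R)) : (\sum_i F i) ^+ k =
    \sum_(x : {ffun 'I_k -> I})
      (\prod_i a (x i))%:C%C * expi ((\sum_i v (x i)) * t).
  rewrite -[in LHS](card_ord k) -prodr_const bigA_distr_bigA /=.
  apply: eq_bigr => x _; rewrite big_split /= mulr_suml expi_sum.
  by rewrite rmorph_prod.
rewrite FE -rmorphXn /= => ->; rewrite raddf_sum /=.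
by apply: eq_bigr => x _; rewrite /= mul0r subr0.
Qed.

End TrigMeans.

(** * Taylor polynomials of the cosine *)

Section CosTaylor.
Variable R : realType.

(** Both [g + f] and [g - f] vanish at 0 and have nonnegative derivative to the right of it, so the
    mean value theorem applies. This is the integration step of the Taylor bounds. *)
Lemma ler_norm_derive (f g f' g' : R -> R) :
  (forall x : R, is_derive x 1 f (f' x)) ->
  (forall x : R, is_derive x 1 g (g' x)) ->
  f 0 = 0 -> g 0 = 0 -> (forall x, 0 <= x -> `|f' x| <= g' x) ->
  forall x, 0 <= x -> `|f x| <= g x.
Proof.
move=> df dg f0 g0 f'g' x x0.
have ge0 (h h' : R -> R) : (forall y : R, is_derive y 1 h (h' y)) -> h 0 = 0 ->
    (forall y, 0 <= y -> 0 <= h' y) -> 0 <= h x.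
  move=> dh h0 h'0.
  have ch : {within `[0, x], continuous h}.
    apply: continuous_subspaceT => y; apply: differentiable_continuous.
    by apply/derivable1_diffP; have [] := dh y.
  have [y] := MVT_segment x0 (fun y _ => dh y) ch.
  rewrite in_itv /= h0 !subr0 => /andP[y0 _] ->.
  by rewrite mulr_ge0 ?h'0.
rewrite ler_norml -subr_ge0 opprK -[X in _ && X]subr_ge0; apply/andP; split.
  apply: (ge0 (f + g) (fun y => f' y + g' y)).
  - by rewrite -[LHS]/(f 0 + g 0) f0 g0 addr0.
  - by move=> y /f'g'; rewrite ler_norml -subr_ge0 opprK addrC => /andP[].
apply: (ge0 (g - f) (fun y => g' y - f' y)).
- by rewrite -[LHS]/(g 0 - f 0) f0 g0 subr0.
- by move=> y /f'g'; rewrite subr_ge0 ler_norml => /andP[].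
Qed.

(** [j] counts terms rather than the degree, so that the remainder has order [x ^+ j.*2]. *)
Definition cos_jet j (x : R) : R :=
  \sum_(i < j) (-1) ^+ i * x ^+ i.*2 / i.*2`!%:R.

Definition sin_jet j (x : R) : R :=
  \sum_(i < j) (-1) ^+ i * x ^+ i.*2.+1 / i.*2.+1`!%:R.

Lemma is_derive_monomial n (x : R) :
  is_derive x 1 (fun y : R => y ^+ n.+1 / n.+1`!%:R) (x ^+ n / n`!%:R).
Proof.
pose a : R := n.+1`!%:R^-1.
have -> : (fun y : R => y ^+ n.+1 / n.+1`!%:R) = a \*: (@id R ^+ n.+1).
  by apply/funext => y /=; rewrite exprfctE [LHS]mulrC.
apply: (is_derive_eq (is_deriveZ a (is_deriveX n.+1 (is_derive_id x 1)))).
rewrite /a /GRing.scale /= mulr1 factS natrM.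
by rewrite [RHS]mulrC invfM mulrAC mulrA mulVf ?mul1r 1?mulrC // pnatr_eq0.
Qed.

Lemma is_derive_sin_jet j (x : R) : is_derive x 1 (sin_jet j) (cos_jet j x).
Proof.
rewrite /sin_jet /cos_jet; elim: j => [|j IH].
  under eq_fun do rewrite big_ord0; rewrite big_ord0; exact: is_derive_cst.
under eq_fun do rewrite big_ord_recr /=; rewrite big_ord_recr /=.
apply: is_deriveD; rewrite -mulrA.
under eq_fun do rewrite -mulrA.
exact: (is_deriveZ _ (is_derive_monomial _ _)).
Qed.

Lemma is_derive_cos_jet j (x : R) :
  is_derive x 1 (cos_jet j.+1) (- sin_jet j x).
Proof.
have -> : cos_jet j.+1 =
    (fun y => 1 - \sum_(i < j) (-1) ^+ i * (y ^+ i.*2.+2 / i.*2.+2`!%:R)).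
  apply/funext => y; rewrite /cos_jet big_ord_recl /= expr0 !mul1r invr1.
  congr (_ + _); rewrite -sumrN; apply: eq_bigr => i _.
  by rewrite /bump /= add1n doubleS exprS mulN1r !mulNr -mulrA.
pose S y : R := \sum_(i < j) (-1) ^+ i * (y ^+ i.*2.+2 / i.*2.+2`!%:R).
suff dS : is_derive x 1 S (sin_jet j x).
  rewrite -(sub0r (sin_jet j x)).
  exact: (is_deriveB (is_derive_cst (1 : R) x 1) dS).
rewrite /S /sin_jet; elim: j {S} => [|j IH].
  under eq_fun do rewrite big_ord0; rewrite big_ord0; exact: is_derive_cst.
under eq_fun do rewrite big_ord_recr /=; rewrite big_ord_recr /=.
apply: is_deriveD; rewrite -mulrA.
exact: (is_deriveZ _ (is_derive_monomial _ _)).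
Qed.

(** Induction from |cos y| <= 1: integrating the bound for the cosine gives the one for the sine,
    and integrating again gives the cosine with one more term. *)
Lemma cos_sin_jet_le j x : 0 <= x ->
  `|cos x - cos_jet j x| <= x ^+ j.*2 / j.*2`!%:R /\
  `|sin x - sin_jet j x| <= x ^+ j.*2.+1 / j.*2.+1`!%:R.
Proof.
have sin_of_cos i :
    (forall y, 0 <= y -> `|cos y - cos_jet i y| <= y ^+ i.*2 / i.*2`!%:R) ->
    forall y, 0 <= y -> `|sin y - sin_jet i y| <= y ^+ i.*2.+1 / i.*2.+1`!%:R.
  apply: (@ler_norm_derive (fun y => sin y - sin_jet i y)
    (fun y => y ^+ i.*2.+1 / i.*2.+1`!%:R)).
  - by move=> y; apply: is_deriveB; exact: is_derive_sin_jet.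
  - by move=> y; exact: is_derive_monomial.
  - rewrite sin0 /sin_jet big1 ?subr0// => k _.
    by rewrite exprS mul0r mulr0 mul0r.
  - by rewrite exprS !mul0r.
suff cosP i : forall y, 0 <= y ->
    `|cos y - cos_jet i y| <= y ^+ i.*2 / i.*2`!%:R.
  by move=> x0; split; [exact: cosP | exact: (sin_of_cos _ (cosP j))].
elim: i => [|i IH].
  by move=> y _; rewrite /cos_jet big_ord0 subr0 expr0 mul1r invr1 cos_max.
apply: (@ler_norm_derive (fun y => cos y - cos_jet i.+1 y)
  (fun y => y ^+ i.*2.+2 / i.*2.+2`!%:R)
  (fun y => - sin y - - sin_jet i y)).
- by move=> y; apply: is_deriveB; exact: is_derive_cos_jet.
- by move=> y; exact: is_derive_monomial.
- rewrite cos0 /cos_jet big_ord_recl big1 => [|k _].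
    by rewrite /= expr0 !mul1r invr1 addr0 subrr.
  by rewrite /bump /= expr0n mulr0 mul0r.
- by rewrite exprS !mul0r.
- by move=> y y0; rewrite opprK addrC distrC; apply: sin_of_cos.
Qed.

Lemma cos_jet_le j x : 0 <= x ->
  `|cos x - cos_jet j x| <= x ^+ j.*2 / j.*2`!%:R.
Proof. by move=> /(cos_sin_jet_le j)[]. Qed.

End CosTaylor.

(** * Cosine series with exponentially decaying coefficients *)

Section ExponentialDecay.
Variable R : realType.
Implicit Types (u v c : R^nat) (rho t : R).

Definition abs_summable u : Prop := cvgn (series (fun n => `|u n|)).

Definition sum u : R := limn (series u).

Lemma cvg_seriesMl k u : cvgn (series u) ->
  series (fun n => k * u n) @ \oo --> k * sum u.
Proof.
move=> cu; have -> : series (fun n => k * u n) = cst k \* series u.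
  by apply/funext => n; rewrite /series /= mulr_sumr.
exact: cvgM (cvg_cst _) cu.
Qed.

Lemma abs_summable_cvg u : abs_summable u -> cvgn (series u).
Proof. exact: (@normed_cvg R R). Qed.

Lemma eq_sum u v : u =1 v -> sum u = sum v.
Proof. by move=> uv; congr sum; apply/funext. Qed.

Lemma abs_summable_le u v : (forall n, `|u n| <= v n) ->
  cvgn (series v) -> abs_summable u.
Proof.
move=> uv; apply: series_le_cvg => // n.
by apply: le_trans (uv n).
Qed.

Lemma abs_summableD u v : abs_summable u -> abs_summable v ->
  abs_summable (fun n => u n + v n).
Proof.
move=> su sv; apply: (@abs_summable_le _ (fun n => `|u n| + `|v n|)).
  by move=> n; exact: ler_normD.
exact: (is_cvg_seriesD su sv).
Qed.

Lemma abs_summableZ k u : abs_summable u -> abs_summable (fun n => k * u n).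
Proof.
move=> su; apply: (@abs_summable_le _ (fun n => `|k| * `|u n|)).
  by move=> n; rewrite normrM.
exact: (cvgP _ (cvg_seriesMl su)).
Qed.

Lemma sumD u v : abs_summable u -> abs_summable v ->
  sum (fun n => u n + v n) = sum u + sum v.
Proof.
move=> su sv.
exact: (lim_seriesD (abs_summable_cvg su) (abs_summable_cvg sv)).
Qed.

Lemma sumZ k u : abs_summable u -> sum (fun n => k * u n) = k * sum u.
Proof.
by move=> su; apply: cvg_lim => //; exact: cvg_seriesMl (abs_summable_cvg su).
Qed.

Lemma sumB u v : abs_summable u -> abs_summable v ->
  sum (fun n => u n - v n) = sum u - sum v.
Proof.
move=> su sv.
exact: (lim_seriesB (abs_summable_cvg su) (abs_summable_cvg sv)).
Qed.

Lemma sum_bigop j (F : nat -> R^nat) : (forall i, abs_summable (F i)) ->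
  abs_summable (fun n => \sum_(i < j) F i n) /\
  sum (fun n => \sum_(i < j) F i n) = \sum_(i < j) sum (F i).
Proof.
move=> sF; elim: j => [|j [sj IH]].
  under eq_fun do rewrite big_ord0; rewrite big_ord0.
  have s0 : series (fun _ : nat => 0 : R) = cst 0.
    by apply/funext => n; rewrite /series /= big1.
  split; last by rewrite /sum s0 lim_cst.
  rewrite /abs_summable; under eq_fun do rewrite normr0.
  by rewrite s0; exact: is_cvg_cst.
under eq_fun do rewrite big_ord_recr /=; rewrite big_ord_recr /=.
by split; [exact: abs_summableD | rewrite sumD // IH].
Qed.

Lemma ler_norm_sum_series u v : (forall n, `|u n| <= v n) ->
  cvgn (series v) -> `|sum u| <= sum v.
Proof.
move=> uv cv; have su := abs_summable_le uv cv.
apply: le_trans (lim_series_norm su) _.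
exact: lim_series_le.
Qed.

Lemma sum_series_tail u v L : (forall n, `|u n| <= v n) -> cvgn (series v) ->
  `|sum u - series u L| <= sum v - series v L.
Proof.
move=> uv cv; have cu := abs_summable_cvg (abs_summable_le uv cv).
have sub_cvg w : cvgn (series w) ->
    (fun n => series w n - series w L) @ \oo --> sum w - series w L.
  by move=> cw; apply: cvgB cw _; exact: cvg_cst.
have cuL := sub_cvg _ cu; have cvL := sub_cvg _ cv.
rewrite -(cvg_lim _ cuL) // -(cvg_lim _ cvL) //.
rewrite -lim_norm; last exact: (cvgP _ cuL).
apply: ler_lim; [exact: is_cvg_norm (cvgP _ cuL) | exact: (cvgP _ cvL) |].
near=> n.
have Ln : (L <= n)%N by near: n; exact: nbhs_infty_ge.
rewrite !sub_series_geq//; apply: le_trans (ler_norm_sum _ _ _) _.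
exact: ler_sum.
Unshelve. all: by end_near. Qed.

Lemma series_le_sum u L : (forall n, 0 <= u n) -> cvgn (series u) ->
  series u L <= sum u.
Proof.
move=> u0 cu; apply: nondecreasing_cvgn_le cu _.
by apply: nondecreasing_series => i _ _.
Qed.

Lemma term_le_sum u n : (forall n, 0 <= u n) -> cvgn (series u) -> u n <= sum u.
Proof.
move=> u0 cu; apply: le_trans (series_le_sum n.+1 u0 cu).
by rewrite seriesSr lerDr sumr_ge0.
Qed.

Definition exp_decay rho c : Prop :=
  exists2 C, 0 <= C & forall n, `|c n| <= C * expR (- (rho * n%:R)).

Definition exp_sum rho : R := sum (fun n => expR (- (rho * n%:R))).

Lemma cvg_series_expR rho : 0 < rho ->
  cvgn (series (fun n => expR (- (rho * n%:R)))).
Proof.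
move=> rho0; have -> : (fun n => expR (- (rho * n%:R))) =
    geometric 1 (expR (- rho)).
  by apply/funext => n /=; rewrite mul1r -mulNr expRM_natr.
apply: is_cvg_geometric_series.
by rewrite ger0_norm ?expR_ge0// expR_lt1 oppr_lt0.
Qed.

Lemma exp_decay_le C rho c : 0 < rho ->
  (forall n, `|c n| <= C * expR (- (rho * n%:R))) ->
  abs_summable c /\ `|sum c| <= C * exp_sum rho.
Proof.
move=> rho0 cC; have ce := cvg_series_expR rho0.
have cCe : cvgn (series (fun n => C * expR (- (rho * n%:R)))).
  exact: (cvgP _ (cvg_seriesMl ce)).
split; first exact: abs_summable_le cC cCe.
have <- : sum (fun n => C * expR (- (rho * n%:R))) = C * exp_sum rho.
  by apply: cvg_lim => //; exact: cvg_seriesMl.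
exact: ler_norm_sum_series cC cCe.
Qed.

Lemma exp_decay_summable rho c : 0 < rho -> exp_decay rho c -> abs_summable c.
Proof. by move=> rho0 [C _ cC]; case: (exp_decay_le rho0 cC). Qed.

Lemma exp_decay_mono rho sigma c : sigma <= rho -> exp_decay rho c ->
  exp_decay sigma c.
Proof.
move=> sr [C C0 cC]; exists C => // n; apply: le_trans (cC n) _.
by rewrite ler_wpM2l // ler_expR lerN2 ler_wpM2r.
Qed.

Lemma exp_decayM B rho c (f : R^nat) : (forall n, `|f n| <= B) ->
  exp_decay rho c -> exp_decay rho (fun n => c n * f n).
Proof.
move=> fB [C C0 cC]; have B0 : 0 <= B by apply: le_trans (fB 0%N).
exists (C * B); first exact: mulr_ge0.
by move=> n; rewrite normrM mulrAC ler_pM.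
Qed.

Lemma exp_decayMcos rho c t : exp_decay rho c ->
  exp_decay rho (fun n => c n * cos (n%:R * t)).
Proof. by apply: (@exp_decayM 1) => n; exact: cos_max. Qed.

Lemma exp_decayB rho c d : exp_decay rho c -> exp_decay rho d ->
  exp_decay rho (fun n => c n - d n).
Proof.
move=> [C C0 cC] [D D0 dD]; exists (C + D); first exact: addr_ge0.
move=> n; apply: le_trans (ler_normB _ _) _.
by rewrite mulrDl lerD.
Qed.

Lemma exp_decayZ k rho c : exp_decay rho c -> exp_decay rho (fun n => k * c n).
Proof.
move=> dc; have : exp_decay rho (fun n => c n * k).
  exact: (@exp_decayM `|k|).
by congr exp_decay; apply/funext => n; rewrite mulrC.
Qed.

Lemma expr_le_expR m t : 0 <= t -> t ^+ m / m`!%:R <= expR t.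
Proof.
move=> t0; case: m => [|m].
  by rewrite expr0 mul1r invr1 -expR0 ler_expR.
by apply: le_trans (expR_ge1Dxn m t0); rewrite lerDr.
Qed.

(* Half of the decay rate absorbs the power of n. *)
Lemma exp_decay_pow_le C rho c t m : 0 < rho -> 0 <= t -> 0 <= C ->
  (forall n, `|c n| <= C * expR (- (rho * n%:R))) -> forall n,
  `|c n| * ((n%:R * t) ^+ m / m`!%:R) <=
    C * (2 * t / rho) ^+ m * expR (- (rho / 2 * n%:R)).
Proof.
move=> rho0 t0 C0 cC n.
(* Rescaled so that x^m / m! <= e^x applies with x = rho n / 2. *)
have -> : n%:R * t = (rho / 2 * n%:R) * (2 * t / rho).
  by field; exact: lt0r_neq0.
rewrite exprMn mulrAC [C * _]mulrC -[(_ / _)^+ m * C * _]mulrA.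
rewrite [`|_| * _]mulrA mulrC.
apply: ler_wpM2l; first by rewrite exprn_ge0 // !mulr_ge0 // invr_ge0 ltW.
have -> : C * expR (- (rho / 2 * n%:R)) =
    C * expR (- (rho * n%:R)) * expR (rho / 2 * n%:R).
  by rewrite -[RHS]mulrA -expRD; congr (_ * expR _); field.
apply: ler_pM => //; last apply: expr_le_expR.
  by rewrite mulr_ge0 ?invr_ge0 // exprn_ge0 // !mulr_ge0 // ltW.
by rewrite !mulr_ge0 // ltW.
Qed.

Lemma exp_decay_moment rho c m : 0 < rho -> exp_decay rho c ->
  exp_decay (rho / 2) (fun n => c n * n%:R ^+ m).
Proof.
move=> rho0 [C C0 cC]; exists (m`!%:R * (C * (2 * 1 / rho) ^+ m)).
  by rewrite !mulr_ge0 // exprn_ge0 // !mulr_ge0 // invr_ge0 ltW.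
move=> n; rewrite normrM normrX normr_nat.
have f0 : m`!%:R != 0 :> R by rewrite pnatr_eq0 -lt0n fact_gt0.
have -> : `|c n| * n%:R ^+ m = m`!%:R * (`|c n| * ((n%:R * 1) ^+ m / m`!%:R)).
  by rewrite mulr1; field.
rewrite -[X in _ <= X]mulrA ler_wpM2l //.
exact: exp_decay_pow_le m rho0 ler01 C0 cC n.
Qed.

(** * Taylor expansion of cosine series at 0 *)

Definition cos_sum c t : R := sum (fun n => c n * cos (n%:R * t)).

(** For exponentially decaying [c], [(-1) ^+ i * moment c i.*2] is the derivative of order 2i of
    [cos_sum c] at 0. *)
Definition moment c m : R := sum (fun n => c n * n%:R ^+ m).

(** The remainder bound of the cosine is summed term by term. [K] depends on neither [j] nor [t], so
    for 2t < rho the Taylor series converges to [cos_sum c t]; this is how analyticity enters. *)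
Lemma cos_sum_jet rho c : 0 < rho -> exp_decay rho c ->
  exists2 K, 0 <= K & forall j t, 0 <= t ->
    `|cos_sum c t -
      \sum_(i < j) (-1) ^+ i * moment c i.*2 * t ^+ i.*2 / i.*2`!%:R|
      <= K * (2 * t / rho) ^+ j.*2.
Proof.
move=> rho0 dc; case: (dc) => C C0 cC.
have rho20 : 0 < rho / 2 by rewrite divr_gt0.
exists (C * exp_sum (rho / 2)).
  apply: le_trans (_ : _ <= `|sum c|) _ => //.
  case: (@exp_decay_le C (rho / 2) c) => // n; apply: le_trans (cC n) _.
  by rewrite ler_wpM2l// ler_expR lerN2 ler_wpM2r//; lra.
move=> j t t0.
pose k i : R := (-1) ^+ i * t ^+ i.*2 / i.*2`!%:R.
have smom i : abs_summable (fun n => c n * n%:R ^+ i).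
  exact: exp_decay_summable rho20 (exp_decay_moment _ rho0 dc).
have skm i : abs_summable (fun n => k i * (c n * n%:R ^+ i.*2)).
  exact: abs_summableZ.
have [sj sjE] := sum_bigop j skm.
have -> : \sum_(i < j) (-1) ^+ i * moment c i.*2 * t ^+ i.*2 / i.*2`!%:R =
    sum (fun n => \sum_(i < j) k i * (c n * n%:R ^+ i.*2)).
  rewrite sjE; apply: eq_bigr => i _; rewrite sumZ // /k.
  by rewrite -/(moment c i.*2); ring.
have scos : abs_summable (fun n => c n * cos (n%:R * t)).
  exact: exp_decay_summable rho0 (exp_decayMcos _ dc).
rewrite /cos_sum -sumB //.
rewrite mulrAC.
apply: (exp_decay_le rho20 _).2 => n.
have -> : c n * cos (n%:R * t) - \sum_(i < j) k i * (c n * n%:R ^+ i.*2) =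
    c n * (cos (n%:R * t) - cos_jet j (n%:R * t)).
  rewrite mulrBr /cos_jet mulr_sumr; congr (_ - _); apply: eq_bigr => i _.
  by rewrite /k exprMn; ring.
apply: le_trans (exp_decay_pow_le j.*2 rho0 t0 C0 cC n).
by rewrite normrM ler_wpM2l// cos_jet_le// mulr_ge0.
Qed.

End ExponentialDecay.

(** * Vanishing moments *)

Section VanishingMoments.
Variable R : realType.
Implicit Types (c : R^nat) (rho t : R).

Lemma le_exprn_eq0 (K x y : R) : 0 <= x < 1 ->
  (forall j, `|y| <= K * x ^+ j.*2) -> y = 0.
Proof.
move=> /andP[x0 x1] yK; apply/eqP; rewrite -normr_eq0 eq_le normr_ge0 andbT.
have x21 : `|x ^+ 2| < 1 by rewrite ger0_norm ?exprn_ge0 // exprn_ilt1.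
have /cvg_geometric : `|x ^+ 2| < 1 := x21.
move=> /(_ K) h; rewrite -(cvg_lim _ h) //.
apply: limr_ge; first exact: (cvgP _ h).
by apply: nearW => j /=; rewrite -exprM mul2n.
Qed.

Lemma series_tail_lt (v : R^nat) e : cvgn (series v) -> 0 < e ->
  exists L0, forall L, (L0 <= L)%N -> sum v - series v L < e.
Proof.
move=> cv e0; have /cvgrPdist_lt/(_ e e0) [L0 _ h] := cv.
by exists L0 => L /h; apply: le_lt_trans; exact: ler_norm.
Qed.

Definition zero_moments c : Prop := forall i, moment c i.*2 = 0.

Lemma momentB rho c d m : 0 < rho -> exp_decay rho c -> exp_decay rho d ->
  moment (fun n => c n - d n) m = moment c m - moment d m.
Proof.
move=> rho0 dc dd; have rho20 : 0 < rho / 2 by rewrite divr_gt0.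
rewrite /moment -sumB; first by apply: eq_sum => n; rewrite mulrBl.
  exact: exp_decay_summable rho20 (exp_decay_moment m rho0 dc).
exact: exp_decay_summable rho20 (exp_decay_moment m rho0 dd).
Qed.

Lemma momentZ rho k c m : 0 < rho -> exp_decay rho c ->
  moment (fun n => k * c n) m = k * moment c m.
Proof.
move=> rho0 dc; have rho20 : 0 < rho / 2 by rewrite divr_gt0.
rewrite /moment -sumZ; first by apply: eq_sum => n; rewrite mulrA.
exact: exp_decay_summable rho20 (exp_decay_moment m rho0 dc).
Qed.

(** The new moment of order 2i is [cos_sum d t]. Every even moment of [d] is one of [c], hence zero,
    and [d] decays at rate [rho / 2], so the jet bounds are powers of 4t / rho < 1. *)
Lemma zero_moments_Mcos rho c t : 0 < rho -> exp_decay rho c ->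
  zero_moments c -> 0 <= t < rho / 4 ->
  zero_moments (fun n => c n * cos (n%:R * t)).
Proof.
move=> rho0 dc c0 /andP[t0 t4] i.
pose d n := c n * n%:R ^+ i.*2.
have rho20 : 0 < rho / 2 by rewrite divr_gt0.
have dd : exp_decay (rho / 2) d by exact: exp_decay_moment.
have -> : moment (fun n => c n * cos (n%:R * t)) i.*2 = cos_sum d t.
  by apply: eq_sum => n; rewrite /d mulrAC.
have [K _ dK] := cos_sum_jet rho20 dd.
apply: (@le_exprn_eq0 K (2 * t / (rho / 2))).
  apply/andP; split; first by rewrite divr_ge0 ?mulr_ge0 // ltW.
  by rewrite ltr_pdivrMr //; lra.
move=> j; apply: le_trans (dK j t t0).
rewrite big1 ?subr0 // => k _.
rewrite (_ : moment d k.*2 = 0) ?mulr0 ?mul0r //.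
rewrite -(c0 (i + k)%N); apply: eq_sum => n.
by rewrite /d doubleD exprD mulrA.
Qed.

(** Analytic continuation in equal steps, through cos ((k + 2) s) = 2 cos ((k + 1) s) cos s - cos (k
    s). A cosine factor preserves the decay rate, so the same step [t] serves for every [k]. *)
Lemma zero_moments_Mcos_nat rho c t k : 0 < rho -> exp_decay rho c ->
  zero_moments c -> 0 <= t < rho / 4 ->
  zero_moments (fun n => c n * cos (n%:R * (k%:R * t))).
Proof.
move=> rho0 dc c0 tr.
suff : zero_moments (fun n => c n * cos (n%:R * (k%:R * t))) /\
    zero_moments (fun n => c n * cos (n%:R * (k.+1%:R * t))) by case.
elim: k => [|k [IH0 IH1]].
  split; last by under eq_fun do rewrite mul1r; exact: zero_moments_Mcos tr.
  by under eq_fun do rewrite mul0r mulr0 cos0 mulr1.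
split=> // i.
have dk := exp_decayMcos (k%:R * t) dc.
have dk1 := exp_decayMcos (k.+1%:R * t) dc.
have -> : (fun n => c n * cos (n%:R * (k.+2%:R * t))) =
    (fun n => 2 * (c n * cos (n%:R * (k.+1%:R * t)) * cos (n%:R * t))
               - c n * cos (n%:R * (k%:R * t))).
  apply/funext => n.
  have -> : n%:R * (k.+2%:R * t) = n%:R * (k.+1%:R * t) + n%:R * t.
    by rewrite -[k.+2%:R]natr1; ring.
  have -> : n%:R * (k%:R * t) = n%:R * (k.+1%:R * t) - n%:R * t.
    by rewrite -[k.+1%:R]natr1; ring.
  by rewrite cosD cosB; ring.
have dk1t := exp_decayMcos t dk1.
rewrite (momentB _ rho0) //; last exact: exp_decayZ.
rewrite (momentZ _ _ rho0) // IH0 (zero_moments_Mcos rho0 dk1 IH1 tr).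
by rewrite mulr0 subr0.
Qed.

(** By continuation the cosine series vanishes on a whole fine grid; its grid average against cos (m
    t) then isolates [c m] up to a tail of the series. *)
Lemma zero_moments_eq0 rho c : 0 < rho -> exp_decay rho c ->
  zero_moments c -> forall m, c m = 0.
Proof.
move=> rho0 dc c0 m; have sc := exp_decay_summable rho0 dc.
apply/eqP; rewrite -normr_eq0 eq_le normr_ge0 andbT.
apply/ler_addgt0Pl => e e0; rewrite addr0.
have [L0 tail] := series_tail_lt sc (divr_gt0 e0 (ltr0n _ 2)).
(* N > 8 pi / rho makes the grid step 2 pi / N smaller than [rho / 4], as continuation requires. *)
pose M := Num.bound (8 * pi / rho : R).
pose L := (maxn L0 (maxn m.+1 M.+1)).
have L0L : (L0 <= L)%N by rewrite leq_maxl.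
have mL : (m < L)%N by rewrite !leq_max leqnn orbT.
have ML : (M < L)%N by rewrite !leq_max leqnn !orbT.
(* For n < L this gives n + m < N, so orthogonality holds on the grid for every term kept. *)
pose N := (L + m)%N.
have N0 : (0 < N)%N by rewrite addn_gt0 (leq_ltn_trans _ mL).
have pi0 : 0 <= pi :> R := pi_ge0 R.
have tN : 0 <= (pi *+ 2 / N%:R : R) < rho / 4.
  apply/andP; split.
    by apply: divr_ge0; [exact: mulrn_wge0 | exact: ler0n].
  rewrite ltr_pdivrMr ?ltr0n // -mulr_natr.
  have : 8 * pi / rho < N%:R :> R.
    apply: lt_le_trans (_ : M%:R <= _).
      by apply: archi_boundP; rewrite divr_ge0 ?mulr_ge0 // ltW.
    by rewrite ler_nat (leq_trans (ltnW ML)) // leq_addr.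
  by rewrite ltr_pdivrMr //; lra.
pose f t := cos_sum c t * cos (m%:R * t).
pose g t := \sum_(n < L) c n * (cos (n%:R * t) * cos (m%:R * t)).
have fN : mean N f = 0.
  rewrite /mean big1 ?mul0r // => j _; rewrite /f.
  rewrite (_ : cos_sum c _ = 0) ?mul0r //.
    rewrite -(zero_moments_Mcos_nat j rho0 dc c0 tN 0%N).
  by apply: eq_sum => n; rewrite expr0 mulr1.
have gN : mean N g = c m * ((1 + (m == 0%N)%:R) / 2).
  rewrite mean_sum (bigD1 (Ordinal mL)) //= meanZ mean_cosMcos ?ltn_add2r //.
  rewrite eqxx big1 ?addr0 => [|i im].
    by rewrite addnn double_eq0.
  rewrite meanZ mean_cosMcos ?ltn_add2r //.
  have -> : (i == m :> nat) = false by apply/negbTE.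
  have -> : (i + m == 0)%N = false.
    apply/negbTE; move: im; apply: contra.
    by rewrite addn_eq0 -val_eqE /= => /andP[/eqP-> /eqP->].
  by rewrite addr0 mul0r mulr0.
have fg : `|mean N f - mean N g| <= e / 2.
  apply: mean_dist => // t.
  have -> : g t = series (fun n => c n * cos (n%:R * t)) L * cos (m%:R * t).
    rewrite /series /= big_mkord mulr_suml.
    by apply: eq_bigr => i _; rewrite mulrA.
  rewrite -mulrBl normrM -[leRHS]mulr1 ler_pM ?cos_max //.
  apply: le_trans (ltW (tail _ L0L)); apply: sum_series_tail => // n.
  by rewrite normrM ler_piMr // cos_max.
(* The factor [(1 + (m == 0%N)%:R) / 2] is at least 1/2, so the tolerance [e / 2] yields |c m| <=
   e. *)
move: fg; rewrite fN gN sub0r normrN normrM.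
have -> : `|(1 + (m == 0%N)%:R) / 2 : R| = (1 + (m == 0%N)%:R) / 2.
  by rewrite ger0_norm // divr_ge0.
have : 1 <= 1 + (m == 0%N)%:R :> R by rewrite lerDl.
have := normr_ge0 (c m); nra.
Qed.

End VanishingMoments.

(** * Return probabilities as averages *)

Section ReturnProbability.
Variable R : realType.
Implicit Types (a : int -> R).

Section Box.
Context (a : int -> R) (d : measure_display) (T : measurableType d).
Context (P : probability T R) (k : nat) (X : 'I_k -> {RV P >-> int}).
Hypothesis aX : iid_steps a P X.
Context (I : finType) (v : I -> int).
Hypothesis v_inj : injective v.

Let boxed (Q : pred {ffun 'I_k -> I}) :=
  \bigcup_(x in [set` Q]) [set t | forall i, X i t = v (x i)].

Let measurable_cell (y : 'I_k -> int) :
  measurable [set t | forall i, X i t = y i].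
Proof.
rewrite (_ : [set t | _] = \bigcap_(i in [set: 'I_k]) (X i @^-1` [set y i])).
  apply: fin_bigcap_measurable => [|i _]; first exact: finite_finset.
  by rewrite -[_ @^-1` _]setTI; exact: measurable_funP.
by apply/seteqP; split=> t /= h i => [_|]; exact: h.
Qed.

(** Tuples of steps are countable, so the event is a countable union of cells, enumerated by
    [pickle_inv]. *)
Let measurable_return : measurable [set t | \sum_(i < k) X i t = 0].
Proof.
pose F n := if pickle_inv n is Some x then
  if \sum_(i < k) (x : {ffun 'I_k -> int}) i == 0
  then [set t | forall i, X i t = x i] else set0 else set0.
have -> : [set t | \sum_(i < k) X i t = 0] = \bigcup_n F n.
  apply/seteqP; split=> t /=.
    move=> Xt0; exists (pickle [ffun i => X i t]) => //; rewrite /F pickleK_inv.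
    under eq_bigr do rewrite ffunE.
    by rewrite Xt0 eqxx => i; rewrite ffunE.
  move=> [n _]; rewrite /F; case: pickle_inv => [x|//].
  case: eqP => // x0 /= Xtx; rewrite -[RHS]x0.
  by under eq_bigr do rewrite Xtx.
apply: bigcupT_measurable => n; rewrite /F; case: pickle_inv => // x.
by case: ifP.
Qed.

Let measurable_boxed Q : measurable (boxed Q).
Proof. by apply: fin_bigcup_measurable => //; exact: finite_finset. Qed.

Lemma probability_boxed Q :
  P (boxed Q) = (\sum_(x | Q x) \prod_i a (v (x i)))%:E.
Proof.
rewrite /boxed measure_fin_bigcup //; last first.
  move=> x y _ _ [t [/= tx ty]]; apply/ffunP => i; apply: v_inj.
  by rewrite -tx -ty.
rewrite -(bigfs _ (index_enum_uniq _)) => [|x _]; last first.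
  by rewrite mem_index_enum.
rewrite -sumEFin; apply: eq_bigr => x _.
transitivity (\prod_(i < k) P (X i @^-1` [set v (x i)]))%E.
  exact: (iid_indep aX (fun i => [set v (x i)])).
rewrite -prodEFin; apply: eq_bigr => i _; exact: (iid_law aX).
Qed.

(** The finite sum is the probability of returning with all steps in the range of [v]. The rest of
    the return event lies in the event that some step leaves this range. *)
Lemma return_probability_boxed :
  `|fine (P [set t | \sum_(i < k) X i t = 0]) -
    \sum_(x : {ffun 'I_k -> I} | \sum_i v (x i) == 0) \prod_i a (v (x i))|
  <= 1 - (\sum_i a (v i)) ^+ k.
Proof.
set Z := [set t | _].
have mZ : measurable Z := measurable_return.
pose Q0 : pred {ffun 'I_k -> I} := fun x => \sum_i v (x i) == 0.
have ZW : Z `&` boxed xpredT = boxed Q0.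
  apply/seteqP; split=> t /=.
    move=> [tZ [x _ tx]]; exists x => //=; apply/eqP; rewrite -[RHS]tZ.
    by apply: eq_bigr => i _; rewrite tx.
  move=> [x /= /eqP x0 tx]; split; last by exists x.
  by rewrite /Z /= -[RHS]x0; apply: eq_bigr => i _; rewrite tx.
have fin A : measurable A -> P A \is a fin_num.
  by move=> mA; exact: fin_num_measure.
have PZ : fine (P Z) = fine (P (Z `\` boxed xpredT)) + fine (P (boxed Q0)).
  rewrite -fineD ?fin //; last exact: measurableD.
  by rewrite -ZW -measureDI.
rewrite PZ (probability_boxed Q0) /= addrK.
have -> : (\sum_i a (v i)) ^+ k = fine (P (boxed xpredT)).
  rewrite probability_boxed /= -[in LHS](card_ord k) -prodr_const.
  by rewrite bigA_distr_bigA.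
rewrite ger0_norm ?fine_ge0 //.
have -> : 1 - fine (P (boxed xpredT)) = fine (P (~` boxed xpredT)).
  by rewrite probability_setC // fineB ?fin.
apply: fine_le; rewrite ?fin //; [exact: measurableD | exact: measurableC |].
apply: le_measure; rewrite ?inE; last by move=> t [].
  exact: measurableD.
exact: measurableC.
Qed.

End Box.

End ReturnProbability.

(** * Folding a walk onto the nonnegative integers *)

Section FoldedWalk.
Variable R : realType.
Implicit Types (a : int -> R) (t : R).

(** [Negz m] is -(m + 1), so a positive [n] collects a_n and a_{-n}, while 0 is counted once. Thus
    [cos_sum (folded_walk a)] is phi_a. *)
Definition folded_walk a (n : nat) : R :=
  a n%:Z + (if n is m.+1 then a (Negz m) else 0).

(** Enumerates the integers of [-L, L]; 0 lies in the left summand, hence the two different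
    sizes. *)
Definition box_val L (i : 'I_L.+1 + 'I_L) : int :=
  match i with inl n => Posz n | inr n => Negz n end.

Lemma box_val_inj L : injective (@box_val L).
Proof. by move=> [i|i] [j|j] //= [/val_inj->]. Qed.

Lemma box_val_le L (i : 'I_L.+1 + 'I_L) : (`|box_val i| <= L)%N.
Proof. by case: i => i /=; rewrite ?absz_nat -ltnS // ltnS. Qed.

Lemma sum_box_even a (f : int -> R) L : (forall n, f (- n) = f n) ->
  \sum_(i : 'I_L.+1 + 'I_L) a (box_val i) * f (box_val i) =
  \sum_(n < L.+1) folded_walk a n * f n%:Z.
Proof.
move=> fN; rewrite big_sumType /=.
under [RHS]eq_bigr do rewrite mulrDl.
rewrite [RHS]big_split /=; congr (_ + _).
rewrite [RHS]big_ord_recl /= mul0r add0r; apply: eq_bigr => i _.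
by rewrite /bump /= add1n NegzE fN.
Qed.

(** The terms at n and -n cancel. This supplies the vanishing sine sum that [sum_cosX] asks for. *)
Lemma sum_box_odd a (f : int -> R) L : symmetric_walk a ->
  (forall n, f (- n) = - f n) ->
  \sum_(i : 'I_L.+1 + 'I_L) a (box_val i) * f (box_val i) = 0.
Proof.
move=> asym fN; rewrite big_sumType /= big_ord_recl /=.
have -> : f 0 = 0.
  have := fN 0; rewrite oppr0 => /eqP.
  by rewrite -addr_eq0 -mulr2n mulrn_eq0 => /eqP.
rewrite mulr0 add0r -big_split big1 // => i _.
by rewrite /bump /= add1n NegzE fN -asym mulrN subrr.
Qed.

Lemma expr_dist_le (x y : R) k : `|x| <= 1 -> `|y| <= 1 ->
  `|x ^+ k - y ^+ k| <= k%:R * `|x - y|.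
Proof.
move=> x1 y1; elim: k => [|k IH]; first by rewrite subrr normr0 mul0r.
have -> : x ^+ k.+1 - y ^+ k.+1 = x * (x ^+ k - y ^+ k) + (x - y) * y ^+ k.
  by rewrite !exprS; ring.
apply: le_trans (ler_normD _ _) _; rewrite -natr1 (mulrDl k%:R) mul1r !normrM.
apply: lerD; first by apply: le_trans IH; rewrite ler_piMl.
by rewrite ler_piMr // normrX exprn_ile1.
Qed.

Section Walk.
Variable a : int -> R.
Hypothesis ha : random_walk a.
Let a_ge0 := walk_ge0 ha.
Let w := folded_walk a.

Lemma folded_walk_ge0 n : 0 <= w n.
Proof. by rewrite /w /folded_walk addr_ge0 //; case: n. Qed.

Lemma folded_walk_sum : cvgn (series w) /\ sum w = 1.
Proof.
pose u n := a (Posz n); pose v n := a (Negz n).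
have u0 n : 0 <= u n by exact: a_ge0.
have v0 n : 0 <= v n by exact: a_ge0.
have uv : (\sum_(n <oo) (u n)%:E + \sum_(n <oo) (v n)%:E = 1)%E.
  rewrite -(walk_sum1 ha) (esumID (range Posz)) //; last first.
    by move=> i _; rewrite lee_fin.
  have -> : [set: int] `&` ~` range Posz = range Negz.
    apply/seteqP; split=> [[n [_ []]|n _]|_ [n _ <-]].
    - by exists n.
    - by exists n.
    - by split=> // -[].
  rewrite setTI !esum_image; [|by move=> x y _ _ []..].
  by congr (_ + _)%E; apply: nneseries_esumT => n; rewrite lee_fin.
have uoo : (\sum_(n <oo) (u n)%:E < +oo)%E.
  apply: (@le_lt_trans _ _ 1%E); last by rewrite ltry.
  by rewrite -uv leeDl // nneseries_ge0 // => n _ _; rewrite lee_fin.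
have voo : (\sum_(n <oo) (v n)%:E < +oo)%E.
  apply: (@le_lt_trans _ _ 1%E); last by rewrite ltry.
  by rewrite -uv leeDr // nneseries_ge0 // => n _ _; rewrite lee_fin.
have cu : cvgn (series u) by exact: nnseries_is_cvg.
have cv : cvgn (series v) by exact: nnseries_is_cvg.
have sE (f : R^nat) : cvgn (series f) -> (\sum_(n <oo) (f n)%:E)%E = (sum f)%:E.
  move=> cf; rewrite /sum -EFin_lim //; congr (limn _); apply/funext => n.
  by rewrite /= sumEFin.
have suv : sum u + sum v = 1.
  by apply: EFin_inj; rewrite EFinD -!sE.
suff h : series w @ \oo --> (1 : R).
  by split; [exact: (cvgP _ h) | exact: cvg_lim h].
rewrite -cvg_shiftS.
(* [Negz] starts at -1, so the negative half lags one index behind. *)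
have -> : [sequence series w n.+1]_n = (fun n => series u n.+1 + series v n).
  apply/funext => n; rewrite /series /= !big_mkord.
  rewrite /w /folded_walk big_split /=; congr (_ + _).
  by rewrite big_ord_recl add0r.
rewrite -suv; apply: cvgD; last exact: cv.
by rewrite (cvg_shiftS (series u)); exact: cu.
Qed.

Lemma folded_walk_decay : symmetric_walk a ->
  exists2 rho, 0 < rho & exp_decay rho w.
Proof.
move=> asym.
have [x [x0 x1 [n0 ax]]] : exists x : R, [/\ 0 < x, x < 1 &
    exists n0 : nat, forall n, (n0 <= n)%N -> a n%:Z `^ n%:R^-1 <= x].
  have /ereal_inf_lt[_ [A [n0 _ n0A] <-] sup1] := walk_limsup ha.
  have [x' supx' x'1] : exists2 x' : R,
      (ereal_sup ((fun n : nat => (a n%:Z `^ n%:R^-1)%:E) @` A) <= x'%:E)%E &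
      x' < 1.
    move: sup1; case: ereal_sup => [r|//|_].
      by rewrite lte_fin => r1; exists r.
    (* Here the supremum is -oo, and any real below 1 would do. *)
    by exists 0; rewrite ?leNye.
  (* The maximum with 1/2 keeps [x] positive, so that [- ln x] is a genuine rate. *)
  exists (Num.max x' (1 / 2)); split.
  - by rewrite lt_max divr_gt0 // orbT.
  - by rewrite gt_max x'1 /=; lra.
  exists n0 => n nn0; rewrite le_max; apply/orP; left.
  rewrite -lee_fin; apply: le_trans supx'.
  by apply: ereal_sup_ubound; exists n => //; exact: n0A.
have sw := folded_walk_sum.
exists (- ln x); first by rewrite oppr_gt0 ln_lt0 // x0 x1.
have xE n : expR (- (- ln x * n%:R)) = x ^+ n.
  by rewrite mulNr opprK expRM_natr lnK.
(* The 2 covers a_n + a_{-n} for n > n0; [x ^- n0] covers n <= n0, where w_n <= 1 <= x^(n - n0). *)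
exists (2 + x ^- n0); first by rewrite addr_ge0 // invr_ge0 exprn_ge0 // ltW.
move=> n; rewrite xE ger0_norm ?folded_walk_ge0 // mulrDl.
have [nn0|nn0] := leqP n0.+1 n.
  apply: le_trans (_ : 2 * x ^+ n <= _); last first.
    by rewrite lerDl mulr_ge0 ?invr_ge0 ?exprn_ge0 // ltW.
  have n_gt0 : (0 < n)%N by apply: leq_trans nn0.
  have an : a n%:Z <= x ^+ n.
    have : (a n%:Z `^ n%:R^-1) ^+ n <= x ^+ n.
      rewrite lerXn2r ?nnegrE ?powR_ge0 ?(ltW x0) //.
      by apply: ax; exact: ltnW.
    rewrite -powR_mulrn ?powR_ge0 // -powRrM mulVf ?pnatr_eq0 -?lt0n //.
    by rewrite powRr1.
  rewrite /w /folded_walk mulr_natl mulr2n lerD //.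
  by case: n n_gt0 an {nn0 ax xE} => // n _; rewrite NegzE -asym.
apply: le_trans (_ : 1 <= _).
  by rewrite -sw.2; apply: term_le_sum sw.1; exact: folded_walk_ge0.
rewrite -[leLHS]add0r lerD ?mulr_ge0 ?exprn_ge0 ?(ltW x0) //.
rewrite ler_pdivlMl ?exprn_gt0 // mulr1.
by rewrite ler_wiXn2l ?(ltW x0) ?(ltW x1).
Qed.

Lemma norm_folded_walkMcos_le n t : `|w n * cos (n%:R * t)| <= w n.
Proof.
have w0 := folded_walk_ge0 n.
by rewrite normrM (ger0_norm w0) ler_piMr ?cos_max.
Qed.

Lemma norm_cos_sum_le1 t : `|cos_sum w t| <= 1.
Proof.
have [cw sw] := folded_walk_sum; rewrite -sw.
by apply: ler_norm_sum_series cw => n; exact: norm_folded_walkMcos_le.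
Qed.

(** Cutting the series at [L] and confining the steps to [-L, L] each cost at most k times the mass
    outside the box; between the two truncated quantities there is equality. *)
Lemma mean_cos_sum_dist k L N : symmetric_walk a -> (k * L < N)%N ->
  `|mean N (fun t => cos_sum w t ^+ k) - fine (return_probability a k)| <=
  2 * (k%:R * (1 - series w L.+1)).
Proof.
move=> asym kLN; have [cw sw] := folded_walk_sum.
have N0 : (0 < N)%N by exact: leq_ltn_trans kLN.
pose phiL t := \sum_(n < L.+1) w n * cos (n%:R * t).
have phiLE t : phiL t =
    \sum_(i : 'I_L.+1 + 'I_L) a (box_val i) * cos ((box_val i)%:~R * t).
  rewrite (@sum_box_even a (fun n => cos (n%:~R * t))) // => n.
  by rewrite mulrNz mulNr cosN.
have sigE : series w L.+1 = \sum_(i : 'I_L.+1 + 'I_L) a (box_val i).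
  rewrite /series /= big_mkord.
  transitivity (\sum_(n < L.+1) w n * 1).
    by apply: eq_bigr => n _; rewrite mulr1.
  rewrite -(@sum_box_even a (fun=> 1)) //.
  by apply: eq_bigr => i _; rewrite mulr1.
have sig0 : 0 <= series w L.+1.
  by apply: sumr_ge0 => i _; exact: folded_walk_ge0.
have sig1 : series w L.+1 <= 1.
  by rewrite -sw; apply: series_le_sum cw; exact: folded_walk_ge0.
have phiL1 t : `|phiL t| <= 1.
  apply: le_trans sig1; rewrite /series /= big_mkord.
  apply: le_trans (ler_norm_sum _ _ _) _; apply: ler_sum => i _.
  exact: norm_folded_walkMcos_le.
have [_ [d [T [P [X [aX _]]]]]] := is_return_probability_ex k ha.
rewrite (return_probabilityE aX).
(* The expanded power has frequencies of size at most k L < N, so the grid average keeps exactly the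
   tuples of steps with sum zero. *)
have boxE : mean N (fun t => phiL t ^+ k) =
    \sum_(x : {ffun 'I_k -> 'I_L.+1 + 'I_L} | \sum_i box_val (x i) == 0)
      \prod_i a (box_val (x i)).
  under eq_mean => t.
    rewrite phiLE sum_cosX; last first.
      apply: (@sum_box_odd a (fun n => sin (n%:~R * t))) => // n.
      by rewrite mulrNz mulNr sinN.
    over.
  rewrite mean_sum [RHS]big_mkcond /=; apply: eq_bigr => x _.
  rewrite meanZ; under eq_mean do rewrite -rmorph_sum.
  rewrite mean_cos; first by case: eqP; rewrite ?mulr1 ?mulr0.
  apply: leq_ltn_trans kLN.
  apply: (@leq_trans (\sum_(i < k) `|box_val (x i)|)%N).
    elim/big_ind2: _ => // m1 n1 m2 n2 h1 h2.
    by apply: leq_trans (leq_add h1 h2); lia.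
  apply: (@leq_trans (\sum_(i < k) L)%N); last first.
    by rewrite sum_nat_const card_ord.
  by apply: leq_sum => i _; exact: box_val_le.
have := return_probability_boxed aX (@box_val_inj L); rewrite -boxE -sigE => h1.
have h2 : `|mean N (fun t => cos_sum w t ^+ k) - mean N (fun t => phiL t ^+ k)|
    <= k%:R * (1 - series w L.+1).
  apply: mean_dist => // t.
  apply: le_trans (expr_dist_le _ (norm_cos_sum_le1 t) (phiL1 t)) _.
  rewrite ler_wpM2l // -sw.
  have := sum_series_tail L.+1 (fun n => norm_folded_walkMcos_le n t) cw.
  by rewrite /phiL /series /= !big_mkord.
have h3 : 1 - series w L.+1 ^+ k <= k%:R * (1 - series w L.+1).
  have s10 : 0 <= 1 - series w L.+1 by rewrite subr_ge0.
  have := @expr_dist_le 1 (series w L.+1) k.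
  rewrite normr1 (ger0_norm sig0) (ger0_norm s10) expr1n => /(_ (lexx _) sig1).
  by apply: le_trans; exact: ler_norm.
rewrite distrC in h1; rewrite mulrC mulr2n mulrDr mulr1.
apply: le_trans (ler_distD (mean N (fun t => phiL t ^+ k)) _ _) _.
by apply: lerD => //; exact: le_trans h1 h3.
Qed.

Lemma mean_cos_sum_cvg k : symmetric_walk a ->
  (fun N => mean N (fun t => cos_sum w t ^+ k)) @ \oo -->
  fine (return_probability a k).
Proof.
move=> asym; have [cw sw] := folded_walk_sum.
apply/cvgrPdist_lt => e e0.
(* [k.+1] instead of [k] avoids a zero denominator at k = 0. *)
have e'0 : 0 < e / (2 * k.+1%:R) by rewrite divr_gt0 // mulr_gt0.
have [L tail] := series_tail_lt cw e'0.
exists (k * L).+1 => // N /= kLN; rewrite distrC.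
apply: le_lt_trans (mean_cos_sum_dist asym kLN) _.
have := tail L.+1 (leqnSn L); rewrite sw ltr_pdivlMr ?mulr_gt0 //.
apply: le_lt_trans.
rewrite [leRHS]mulrC -mulrA ler_wpM2l // ler_wpM2r ?ler_nat //.
by rewrite subr_ge0 -sw; apply: series_le_sum cw; exact: folded_walk_ge0.
Qed.

End Walk.
End FoldedWalk.

(** * Comparison of high powers *)

Lemma sumr_middle_block (V : nmodType) (A : V) Q M : (1 < Q)%N ->
  \sum_(j < Q * M | (M <= j < 2 * M)%N) A = A *+ M.
Proof.
move=> Q2; have M2 : (2 * M <= Q * M)%N by rewrite leq_mul2r Q2 orbT.
rewrite -(big_mkord (fun j => M <= j < 2 * M)%N (fun=> A)).
rewrite (big_cat_nat (n := 2 * M)) //= (big_cat_nat (n := M)) ?leq_pmull //=.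
rewrite big_nat_cond big_pred0 => [|j]; last first.
  by rewrite leq0n /= andbA; case: ltnP.
rewrite add0r -[RHS]addr0; congr (_ + _).
  rewrite big_nat_cond (eq_bigl (fun j => M <= j < 2 * M)%N); last first.
    by move=> j; rewrite andbb.
  by rewrite -big_nat sumr_const_nat mul2n -addnn addnK.
rewrite big_nat_cond big_pred0 // => j.
by rewrite andbCA ltnNge; case: leqP; rewrite ?andbF.
Qed.

Section Comparison.
Variable R : realType.
Implicit Types (F G : R -> R) (t : R).

(* The points of the regular N-grid in [2 pi / Q, 4 pi / Q] make up a fixed
   proportion 1 / Q of the grid, and there the gap between the k-th powers
   exceeds any contribution of the region where both functions are <= r. *)
Lemma mean_powers_separate F G (eps r q eta : R) (Q : nat) :
  (forall t, 0 <= F t) -> (forall t, 0 <= G t) ->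
  (forall t, F (pi *+ 2 - t) = F t) -> (forall t, G (pi *+ 2 - t) = G t) ->
  (forall t, 0 <= t <= eps -> G t <= F t) ->
  (forall t, eps <= t <= pi *+ 2 - eps -> G t <= r) ->
  0 <= r < q -> 0 < eta -> (1 < Q)%N -> pi *+ 4 / Q%:R <= eps ->
  (forall t, pi *+ 2 / Q%:R <= t <= pi *+ 4 / Q%:R ->
    q <= G t /\ eta <= F t - G t) ->
  exists k, ~ (fun N => mean N (fun t => F t ^+ k) - mean N (fun t => G t ^+ k))
    @ \oo --> (0 : R).
Proof.
move=> F0 G0 Fpi Gpi GF Gr /andP[r0 rq] eta0 Q2 Qeps near0.
have Q0 : (0 < Q)%N := ltnW Q2.
have q0 : 0 < q by apply: le_lt_trans rq.
have QR : 0 < Q%:R :> R by rewrite ltr0n.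
have pi0 : 0 < pi :> R := pi_gt0 R.
(* Such a [k] exists because r (r / q)^k tends to 0. *)
have [k kP] : exists k, r ^+ k.+1 < eta * q ^+ k / Q%:R.
  have rq1 : `|r / q| < 1.
    by rewrite ger0_norm ?divr_ge0 ?(ltW q0)// ltr_pdivrMr// mul1r.
  have /cvgrPdist_lt/(_ (eta / Q%:R)) h := cvg_geometric r rq1.
  have /h[k0 _ /(_ k0 (leqnn _))] : 0 < eta / Q%:R by exact: divr_gt0.
  rewrite /= sub0r normrN ger0_norm => [h0|]; last first.
    by rewrite mulr_ge0 // exprn_ge0 // divr_ge0 // ltW.
  exists k0; move: h0; rewrite expr_div_n mulrA ltr_pdivrMr ?exprn_gt0 //.
  by rewrite -exprS mulrAC.
exists k.+1 => h.
pose kap := eta * q ^+ k / Q%:R - r ^+ k.+1.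
have kap0 : 0 < kap by rewrite subr_gt0.
move: h => /cvgrPdist_lt/(_ kap kap0)[M0 _ h].
pose M := M0.+1.
(* With [N] a multiple of [Q], the indices from M to 2M - 1 give grid points in
   [2 pi / Q, 4 pi / Q]. *)
pose N := (Q * M)%N.
have MR : 0 < M%:R :> R by rewrite ltr0n.
have M0N : (M0 <= N)%N by apply: (leq_trans (leqnSn M0)); exact: leq_pmull.
have NR : N%:R = Q%:R * M%:R :> R by rewrite natrM.
have N0 : 0 < N%:R :> R by rewrite NR mulr_gt0.
have := h N M0N; rewrite /= sub0r normrN; apply/negP; rewrite -leNgt.
apply: le_trans (ler_norm _); rewrite -meanB.
rewrite /mean ler_pdivlMr //.
pose A := eta * q ^+ k.
(* The bound is spread over the grid points, which reduces the claim to a pointwise inequality. *)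
have -> : kap * N%:R =
    \sum_(j < N) ((if (M <= j < 2 * M)%N then A else 0) - r ^+ k.+1).
  rewrite sumrB sumr_const card_ord -big_mkcond /=.
  rewrite -[r ^+ k.+1 *+ N]mulr_natr NR.
  have -> : \sum_(i < N | (M <= i < 2 * M)%N) A = M%:R * A.
    by rewrite sumr_middle_block // mulr_natl.
  have alg (x y m n : R) : n != 0 ->
      (x / n - y) * (n * m) = m * x - y * (n * m).
    by move=> n0; field.
  by rewrite /kap -/A alg // lt0r_neq0.
apply: ler_sum => j _; set t := _ * _.
have tM : t = j%:R / M%:R * (pi *+ 2 / Q%:R).
  by rewrite /t NR; field; rewrite !lt0r_neq0.
have p2 : 0 <= pi *+ 2 :> R by apply: mulrn_wge0; exact: ltW.
have pQ : 0 <= pi *+ 2 / Q%:R :> R by apply: divr_ge0 => //; exact: ltW.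
have t0 : 0 <= t by rewrite tM mulr_ge0 // divr_ge0 // ltW.
have rk0 : 0 <= r ^+ k.+1 by exact: exprn_ge0.
have powle (x y : R) : 0 <= x -> x <= y -> 0 <= y ^+ k.+1 - x ^+ k.+1.
  by move=> x0 xy; rewrite subr_ge0 lerXn2r ?nnegrE // (le_trans x0).
case: ifP => [/andP[Mj j2M]|_].
  rewrite lerBlDr -[leLHS]addr0; apply: lerD => //.
  have [] := near0 t.
    rewrite tM; apply/andP; split.
      by rewrite ler_peMl // ler_pdivlMr // mul1r ler_nat.
    rewrite (_ : pi *+ 4 / Q%:R = 2 * (pi *+ 2 / Q%:R) :> R).
      rewrite ler_wpM2r //.
      by rewrite ltW // ltr_pdivrMr // -natrM ltr_nat.
    by rewrite mulrA mulr_natl -(mulrnA pi 2 2).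
  move=> qG etaFG.
  have GFt : G t <= F t by rewrite -subr_ge0 (le_trans _ etaFG) // ltW.
  (* For F >= G >= 0, F^(k+1) - G^(k+1) >= (F - G) G^k. *)
  apply: le_trans (_ : (F t - G t) * G t ^+ k <= _).
    apply: ler_pM => //; [exact: ltW | by rewrite exprn_ge0 // ltW |].
    by rewrite lerXn2r ?nnegrE ?(ltW q0).
  by rewrite mulrBl !exprS lerD2r ler_wpM2l // lerXn2r ?nnegrE.
(* Off the block: near 0, and near 2 pi by reflection, the difference is nonnegative; in between, F
   >= 0 and G <= r bound it below by -r^(k+1). *)
rewrite sub0r.
have [teps|epst] := leP t eps.
  by rewrite (le_trans _ (powle _ _ _ _)) ?oppr_le0 // GF // t0.
have [tpi|pit] := leP t (pi *+ 2 - eps).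
  rewrite lerNl opprB -[leRHS]subr0 lerB ?exprn_ge0 //.
  by rewrite lerXn2r ?nnegrE // Gr // tpi ltW.
have t2pi : t <= pi *+ 2.
  rewrite /t mulrCA -[leRHS]mulr1 ler_wpM2l //.
  by rewrite ler_pdivrMr // mul1r ler_nat ltnW.
rewrite -Fpi -Gpi (le_trans _ (powle _ _ _ _)) ?oppr_le0 // GF //.
rewrite subr_ge0 t2pi /=.
by rewrite lerBlDr -lerBlDl ltW.
Qed.

End Comparison.

(** * Rigidity *)

Section Rigidity.
Variable R : realType.
Implicit Types (a b : int -> R) (t : R).

Lemma cos_sum_2piB (c : R^nat) t : cos_sum c (pi *+ 2 - t) = cos_sum c t.
Proof.
apply: eq_sum => n; congr (_ * _).
by rewrite mulrBr addrC cosD2pi_nat cosN.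
Qed.

(** Provides closure under subtraction for the subgroup used in [primitive_gap]. *)
Lemma sinB_sqr_le (x y : R) : sin (x - y) ^+ 2 <= 2 * (sin x ^+ 2 + sin y ^+ 2).
Proof.
rewrite sinB; have := cos2Dsin2 x; have := cos2Dsin2 y.
move: (sin x) (cos x) (sin y) (cos y) => s c s' c' h' h.
have : 0 <= (s * c' + c * s') ^+ 2 by exact: sqr_ge0.
have : s ^+ 2 * c' ^+ 2 <= s ^+ 2.
  by rewrite ler_piMr ?sqr_ge0 // -h' lerDl sqr_ge0.
have : c ^+ 2 * s' ^+ 2 <= s' ^+ 2.
  by rewrite ler_piMl ?sqr_ge0 // -h lerDl sqr_ge0.
by nra.
Qed.

(** Since the weights sum to 1, the right side is a series of nonnegative terms w_i (1 - cos (i t)),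
    of which one is kept. *)
Lemma one_sub_cos_sum_ge a n t : random_walk a ->
  folded_walk a n * (1 - cos (n%:R * t)) <= 1 - cos_sum (folded_walk a) t.
Proof.
move=> ha; set w := folded_walk a; have [cw sw] := folded_walk_sum ha.
have w0 := folded_walk_ge0 ha.
have sumw : abs_summable w.
  by apply: abs_summable_le cw => i; rewrite ger0_norm ?w0.
have swc : abs_summable (fun i => w i * cos (i%:R * t)).
  by apply: abs_summable_le cw => i; exact: norm_folded_walkMcos_le.
rewrite -[X in X - cos_sum _ _]sw -sumB //.
rewrite (@eq_sum _ _ (fun i => w i * (1 - cos (i%:R * t)))) => [|i]; last first.
  by rewrite mulrBr mulr1.
apply: (@term_le_sum _ (fun i => w i * (1 - cos (i%:R * t)))) => [i|].
  by rewrite mulr_ge0 ?w0 // subr_ge0 cos_le1.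
rewrite (_ : (fun _ => _) = (fun i => w i - w i * cos (i%:R * t))).
  exact: (is_cvg_seriesB (abs_summable_cvg sumw) (abs_summable_cvg swc)).
by apply/funext => i; rewrite mulrBr mulr1.
Qed.

(* The integers m for which sin^2 (m t) is dominated by 1 - phi (2 t) form a
   subgroup containing the step sizes; primitivity puts 1 in it. *)
Lemma primitive_gap a : random_walk a -> primitive_walk a ->
  exists2 C, 1 <= C &
    forall t, sin t ^+ 2 <= C * (1 - cos_sum (folded_walk a) (2 * t)).
Proof.
move=> ha prim; set w := folded_walk a.
pose H := [set m : int | exists C, forall t,
  sin (m%:~R * t) ^+ 2 <= C * (1 - cos_sum w (2 * t))].
have subH : int_subgroup H.
  split; first by exists 0 => t; rewrite mulr0z mul0r sin0 expr0n mul0r lexx.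
  move=> m n [C mC] [D nD]; exists (2 * (C + D)) => t.
  rewrite rmorphB /= mulrBl; apply: le_trans (sinB_sqr_le _ _) _.
  by rewrite -mulrA ler_wpM2l // mulrDl lerD.
have stepH : step_sizes a `<=` H.
  move=> _ [n an0 ->].
  have wn0 : 0 < w `|n|%N.
    have : 0 < a n by rewrite lt0r an0 (walk_ge0 ha).
    move=> /lt_le_trans; apply; rewrite /w /folded_walk.
    case: n {an0} => n /=; last by rewrite lerDr (walk_ge0 ha).
    by rewrite lerDl; case: n => [|n]; rewrite ?(walk_ge0 ha).
  (* The constant 1 / w_n works because 1 - cos (2nt) = 2 sin^2 (nt). *)
  exists (w `|n|%N)^-1 => t; rewrite -ler_pdivrMl ?invr_gt0 // invrK.
  have := @one_sub_cos_sum_ge a `|n|%N (2 * t) ha; apply: le_trans.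
  rewrite ler_wpM2l ?(ltW wn0) //.
  have -> : `|n|%N%:R * (2 * t) = (`|n|%N%:R * t) *+ 2.
    by rewrite mulrCA (mulr_natl _ 2).
  rewrite cos_mulr2n -[(`|n|)%:~R]/(`|n|%N%:R).
  have := cos2Dsin2 (`|n|%N%:R * t); have := sqr_ge0 (sin (`|n|%N%:R * t)).
  by rewrite -mulr_natr; lra.
have : H 1.
  have : generated_subgroup (step_sizes a) 1 by rewrite prim.
  exact: smallest_sub.
move=> [C HC]; exists (Num.max 1 C); first by rewrite le_max lexx.
move=> t; have := HC t; rewrite mul1r => /le_trans; apply.
rewrite ler_wpM2r //; last by rewrite le_max lexx orbT.
rewrite subr_ge0; apply: le_trans (ler_norm _) _; exact: norm_cos_sum_le1.
Qed.

Lemma small_sqr (A B : R) : 0 <= A -> 0 < B ->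
  exists2 e, 0 < e <= 1 & forall t, 0 <= t <= e -> A * t ^+ 2 <= B.
Proof.
move=> A0 B0; have A1 : 0 < A + 1 by rewrite ltr_wpDl.
(* The bound 1 gives t^2 <= t; [A + 1] is a nonzero denominator even when A = 0. *)
exists (Num.min 1 (B / (A + 1))).
  by rewrite lt_min ltr01 divr_gt0 // ge_min lexx.
move=> t /andP[t0]; rewrite le_min ler_pdivlMr // => /andP[t1 tB].
apply: le_trans tB; rewrite mulrC; apply: ler_pM; rewrite ?sqr_ge0 ?lerDl //.
by rewrite expr2 ler_piMl.
Qed.

(** sin x = cos |x - pi / 2|, and the cosine decreases on [0, pi]. *)
Lemma sin_ge_sym (e x : R) : 0 <= e -> e <= x <= pi - e -> sin e <= sin x.
Proof.
move=> e0 /andP[ex xe].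
rewrite -(cosBpihalf e) -(cosBpihalf x).
rewrite -[cos (x - _)]cos_norm -[cos (e - _)]cos_norm.
have epi : e <= pi / 2 by lra.
have -> : `|e - pi / 2| = pi / 2 - e by rewrite distrC ger0_norm // subr_ge0.
have h : `|x - pi / 2| <= pi / 2 - e.
  by rewrite ler_norml; apply/andP; split; lra.
have pi0 : 0 <= pi :> R by exact: pi_ge0.
move: h; rewrite le_eqVlt => /orP[/eqP->//|h].
by rewrite ltW // ltr_cos // in_itv /=; apply/andP; split=> //; lra.
Qed.

Lemma cvg_sum0 (f : nat -> R^nat) (k : R^nat) m :
  (forall i, f i @ \oo --> (0 : R)) ->
  (fun N => \sum_(i < m) k i * f i N) @ \oo --> (0 : R).
Proof.
move=> f0; elim: m => [|m IH].
  by under eq_fun do rewrite big_ord0; exact: cvg_cst.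
under eq_fun do rewrite big_ord_recr /=.
have := cvgD IH (cvgM (cvg_cst (k m)) (f0 m)); rewrite mulr0 addr0.
exact.
Qed.

(** One-sided form of the comparison: a positive leading coefficient would put phi_a above phi_b
    near 0, and the gap for [b] would then separate the averages of high powers. The other sign
    follows by exchanging [a] and [b]. *)
Lemma first_moment_npos a b j : random_walk a -> random_walk b ->
  symmetric_walk a -> symmetric_walk b -> primitive_walk b ->
  (forall k, (0 < k)%N -> return_probability a k = return_probability b k) ->
  let c n := folded_walk a n - folded_walk b n in
  (forall i, (i < j)%N -> moment c i.*2 = 0) ->
  ~ 0 < (-1) ^+ j * moment c j.*2.
Proof.
move=> ha hb sa sb pb hret c cj Mj.
set wa := folded_walk a; set wb := folded_walk b.
have [rho [rho0 da db]] : exists rho,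
    [/\ 0 < rho, exp_decay rho wa & exp_decay rho wb].
  have [ra ra0 da] := folded_walk_decay ha sa.
  have [rb rb0 db] := folded_walk_decay hb sb.
  exists (Num.min ra rb); split; first by rewrite lt_min ra0.
    by apply: exp_decay_mono da; rewrite ge_min lexx.
  by apply: exp_decay_mono db; rewrite ge_min lexx orbT.
have dc : exp_decay rho c by exact: exp_decayB.
(* The affine change maps [-1, 1] to [0, 1], where powers are monotone. *)
pose F t := (1 + cos_sum wa t) / 2; pose G t := (1 + cos_sum wb t) / 2.
have FGE t : F t - G t = cos_sum c t / 2.
  have -> : cos_sum c t = cos_sum wa t - cos_sum wb t.
    rewrite /cos_sum -sumB; first by apply: eq_sum => n; rewrite mulrBl.
      exact: exp_decay_summable rho0 (exp_decayMcos _ da).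
    exact: exp_decay_summable rho0 (exp_decayMcos _ db).
  by rewrite /F /G; field.
have range_g w' t : `|cos_sum w' t| <= 1 -> 0 <= (1 + cos_sum w' t) / 2 :> R.
  by rewrite ler_norml => /andP[h _]; rewrite divr_ge0 // -lerBlDl sub0r.
pose mu := (-1) ^+ j * moment c j.*2 / j.*2`!%:R.
have mu0 : 0 < mu by rewrite divr_gt0 // ltr0n fact_gt0.
have [K K0 cK] := cos_sum_jet rho0 dc.
have [eps1 /andP[eps10 eps11] h1] : exists2 e, 0 < e <= 1 &
    forall t, 0 <= t <= e -> mu / 2 * t ^+ j.*2 <= cos_sum c t.
  (* The jet with j + 1 terms has remainder A t^(2j + 2), which is at most half of mu t^(2j) once A
     t^2 <= mu / 2. *)
  pose A := K * (2 / rho) ^+ j.+1.*2.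
  have A0 : 0 <= A by rewrite mulr_ge0 // exprn_ge0 // divr_ge0 // ltW.
  have [e e01 he] := small_sqr A0 (divr_gt0 mu0 (ltr0n _ 2)).
  exists e => // t te; have t0 : 0 <= t by case/andP: te.
  have jet : `|cos_sum c t - mu * t ^+ j.*2| <= A * t ^+ 2 * t ^+ j.*2.
    have := cK j.+1 t t0; set B := _ * _ ^+ _.
    rewrite big_ord_recr /= big1 => [|i _]; last first.
      by rewrite cj // mulr0 !mul0r.
    have -> : B = A * t ^+ 2 * t ^+ j.*2.
      have tj : t ^+ j.+1.*2 = t ^+ 2 * t ^+ j.*2 := exprD t 2 j.*2.
      by rewrite /B /A [2 * t / rho]mulrAC exprMn tj !mulrA.
    by rewrite add0r /mu [X in _ - X]mulrAC.
  have := ler_wpM2r (exprn_ge0 j.*2 t0) (he t te).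
  move: jet; rewrite ler_norml => /andP[jet _]; move: jet.
  move: (A * t ^+ 2 * t ^+ j.*2) (cos_sum c t) (t ^+ j.*2) => y z u; lra.
have [C C1 gap] := primitive_gap hb pb.
have C0 : 0 < C by apply: lt_le_trans C1.
have pi2 : 2 <= pi :> R by exact: pi_ge2.
(* Lower bound of sin^2 (t / 2) for t in [eps1, 2 pi - eps1]. *)
pose sn := sin (eps1 / 2) ^+ 2.
have sn0 : 0 < sn.
  rewrite exprn_gt0 // sin_gt0_pi //.
  by apply/andP; split; [rewrite divr_gt0 | lra].
have sn1 : sn <= 1.
  by rewrite /sn sin2cos2 gerBl sqr_ge0.
(* There the gap gives 1 - phi_b >= sn / C = 2x, that is G <= 1 - x. Near 0, [G] will exceed 1 - x /
   2, so these are the levels r and q. *)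
pose x := sn / C / 2.
have x0 : 0 < x by rewrite !divr_gt0.
have x12 : x <= 1 / 2.
  by rewrite ler_wpM2r // ler_pdivrMr // mul1r (le_trans sn1).
have [Kb Kb0 bK] := cos_sum_jet rho0 db.
have mb0 : moment wb 0 = 1.
  by have [_ <-] := folded_walk_sum hb; apply: eq_sum => n; rewrite expr0 mulr1.
have [eps2 /andP[eps20 _] h2] : exists2 e, 0 < e <= 1 &
    forall t, 0 <= t <= e -> 1 - x / 2 <= G t.
  have K2 : 0 <= Kb * (2 / rho) ^+ 2.
    by rewrite mulr_ge0 // exprn_ge0 // divr_ge0 // ltW.
  have [e e01 he] := small_sqr K2 x0.
  exists e => // t te; have t0 : 0 <= t by case/andP: te.
  have := bK 1%N t t0; rewrite big_ord1 /= mb0 !expr0 !mul1r invr1.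
  have -> : 2 * t / rho = 2 / rho * t by rewrite mulrAC.
  rewrite exprMn mulrA ler_norml => /andP[h' _].
  have := he t te; rewrite /G; lra.
pose del := Num.min eps1 eps2.
have del0 : 0 < del by rewrite lt_min eps10.
have pi40 : 0 <= pi *+ 4 :> R by rewrite mulrn_wge0 // pi_ge0.
(* The bound gives 4 pi / Q <= del, and the two successors ensure Q > 1. *)
pose Q := (Num.bound (pi *+ 4 / del : R)).+2.
have QR : 0 < Q%:R :> R by rewrite ltr0n.
have Qdel : pi *+ 4 / Q%:R <= del.
  rewrite ler_pdivrMr // mulrC -ler_pdivrMr //.
  apply: ltW; apply: lt_le_trans (archi_boundP _) _.
    by rewrite divr_ge0 // ltW.
  by rewrite ler_nat /Q; exact: (leq_trans (leqnSn _) (leqnSn _)).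
have pQ0 : 0 < pi *+ 2 / Q%:R :> R by rewrite divr_gt0 // pmulrn_lgt0 // pi_gt0.
have [k] : exists k,
    ~ (fun N => mean N (fun t => F t ^+ k) - mean N (fun t => G t ^+ k))
      @ \oo --> (0 : R).
  (* The gap [eta] comes from F - G = [cos_sum c t / 2] >= (mu / 4) t^(2j) with t >= 2 pi / Q. *)
  apply: (@mean_powers_separate R F G eps1 (1 - x) (1 - x / 2)
  (mu / 4 * (pi *+ 2 / Q%:R) ^+ j.*2) Q
  (fun t => range_g _ _ (norm_cos_sum_le1 ha t))
  (fun t => range_g _ _ (norm_cos_sum_le1 hb t))).
  - by move=> t; rewrite /F cos_sum_2piB.
  - by move=> t; rewrite /G cos_sum_2piB.
  - move=> t te; rewrite -subr_ge0 FGE divr_ge0 //.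
    apply: le_trans (h1 t te).
    rewrite mulr_ge0 ?exprn_ge0 //; last by case/andP: te.
    by rewrite divr_ge0 // ltW.
  - move=> t /andP[et te].
    have := gap (t / 2); have -> : 2 * (t / 2) = t by field.
    move=> gapt; have : sn <= sin (t / 2) ^+ 2.
      rewrite lerXn2r ?nnegrE //.
      + by rewrite sin_ge0_pi //; apply/andP; split; lra.
      + by rewrite sin_ge0_pi //; apply/andP; split; lra.
      + by apply: sin_ge_sym; [lra | apply/andP; split; lra].
    move=> /le_trans/(_ gapt); rewrite mulrC -ler_pdivrMr // => h.
    by rewrite /G /x; lra.
  - by apply/andP; split; lra.
  - by rewrite mulr_gt0 ?divr_gt0 // exprn_gt0.
  - by [].
  - by apply: le_trans Qdel _; rewrite ge_min lexx.
  - move=> t /andP[tl tu].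
    have t0 : 0 <= t by apply: le_trans tl; exact: ltW.
    have /andP[t1 t2] : (t <= eps1) && (t <= eps2).
      by rewrite -le_min (le_trans tu).
    split; first by apply: h2; rewrite t0.
    rewrite FGE; have /h1 h : 0 <= t <= eps1 by rewrite t0.
    have : (pi *+ 2 / Q%:R) ^+ j.*2 <= t ^+ j.*2.
      by rewrite lerXn2r ?nnegrE // ltW.
    move=> /(ler_wpM2l (ltW mu0)); lra.
apply.
pose D i N :=
  mean N (fun t => cos_sum wa t ^+ i) - mean N (fun t => cos_sum wb t ^+ i).
have D0 i : D i @ \oo --> (0 : R).
  (* Equality of return probabilities is given for positive exponents; at exponent 0 both averages
     coincide. *)
  case: (posnP i) => [->|i0].
    rewrite (_ : D 0%N = cst 0); first exact: cvg_cst.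
    by apply/funext => N; rewrite /D subrr.
  rewrite -(subrr (fine (return_probability a i))) {2}hret //.
  exact: (cvgB (@mean_cos_sum_cvg _ _ ha i sa) (@mean_cos_sum_cvg _ _ hb i sb)).
(* The binomial expansion of ((1 + phi) / 2)^k reduces the claim to averages of powers of phi. *)
rewrite (_ : (fun N => _) =
    (fun N => \sum_(i < k.+1) (2^-1 ^+ k * 'C(k, i)%:R) * D i N)).
  exact: (@cvg_sum0 D (fun i => 2^-1 ^+ k * 'C(k, i)%:R) k.+1 D0).
apply/funext => N.
have expand w' : mean N (fun t => ((1 + cos_sum w' t) / 2) ^+ k) =
    \sum_(i < k.+1)
      (2^-1 ^+ k * 'C(k, i)%:R) * mean N (fun t => cos_sum w' t ^+ i).
  under [RHS]eq_bigr do rewrite -meanZ.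
  rewrite -mean_sum; apply: eq_mean => t.
  rewrite exprMn exprDn mulrC mulr_sumr; apply: eq_bigr => i _.
  by rewrite expr1n mul1r -mulrA mulr_natl.
by rewrite !expand -sumrB; apply: eq_bigr => i _; rewrite -mulrBr.
Qed.

Lemma folded_walk_inj a b : symmetric_walk a -> symmetric_walk b ->
  folded_walk a =1 folded_walk b -> a =1 b.
Proof.
move=> sa sb ab.
have pos n : a (Posz n) = b (Posz n).
  have := ab n; rewrite /folded_walk; case: n => [|n]; first by rewrite !addr0.
  rewrite !NegzE -sa -sb; lra.
by case=> n; rewrite ?NegzE -?sa -?sb ?pos // sa sb opprK pos.
Qed.

End Rigidity.

Theorem theorem1p1 (R : realType) (a b : int -> R)
    (ha : random_walk a) (hb : random_walk b)
    (ha_sym : symmetric_walk a) (hb_sym : symmetric_walk b)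
    (ha_prim : primitive_walk a) (hb_prim : primitive_walk b)
    (hret : forall k : nat, (0 < k)%N ->
      return_probability a k = return_probability b k) :
  forall n : int, a n = b n.
Proof.
have [ra ra0 da] := folded_walk_decay ha ha_sym.
have [rb rb0 db] := folded_walk_decay hb hb_sym.
pose rho := Num.min ra rb.
have rho0 : 0 < rho by rewrite lt_min ra0.
have {}da : exp_decay rho (folded_walk a).
  by apply: exp_decay_mono da; rewrite ge_min lexx.
have {}db : exp_decay rho (folded_walk b).
  by apply: exp_decay_mono db; rewrite ge_min lexx orbT.
apply: folded_walk_inj => // n; apply/eqP; rewrite -subr_eq0; apply/eqP.
pose c n := folded_walk a n - folded_walk b n.
apply: (zero_moments_eq0 rho0 (exp_decayB da db)).
apply: contrapT => /existsNP[i /eqP Mi].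
have ex : exists i, moment c i.*2 != 0 by exists i.
(* Minimality makes moment 2j the first nonzero Taylor coefficient of phi_a - phi_b. *)
case: (ex_minnP ex) => j Mj minj.
have cj l : (l < j)%N -> moment c l.*2 = 0.
  by move=> lj; apply/eqP; apply: contraTT lj => /minj; rewrite -leqNgt.
have : (-1) ^+ j * moment c j.*2 != 0 by rewrite mulf_neq0 // signr_eq0.
rewrite neq_lt => /orP[neg|]; last exact: first_moment_npos cj.
(* Negative sign: exchanging the walks negates every moment. *)
pose c' n := folded_walk b n - folded_walk a n.
have c'E l : moment c' l = - moment c l.
  by rewrite (momentB _ rho0 db da) (momentB _ rho0 da db) opprB.
apply: (@first_moment_npos R b a j) => //.
- by move=> k k0; rewrite hret.
- by move=> l lj; rewrite c'E cj // oppr0.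
- by rewrite c'E mulrN oppr_gt0.
Qed.
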